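(* The set $C_{\overline{D(\sigma)_{\rm SP}},\Pi}:=\operatorname{conv}\{\Pi(u):\ u\in\overline{D(\sigma)_{\rm SP}}\}\subseteq\mathbb{R}^M$ is a $0/1$ polytope, i.e., the convex hull of a (possibly empty) subset of $\{0,1\}^M$.
   Context: Let $T>0$, $\sigma>0$, $p\in[1,\infty)$, and let $$D(\sigma):=\{u\in BV(0,T):\ u(t)\in\{0,1\}\text{ for almost all }t\in(0,T),\ |u|_{BV(0,T)}\le\sigma\},$$ where $|u|_{BV(0,T)}$ denotes the total variation. Pointwise evaluation: every $u\in BV(0,T)$ has a unique right-continuous representative $\hat u$ on $(0,T)$; for $t\in(0,T)$, ''$u(t)=b$'' means $\hat u(t)=b$, and ''$u(0)=b$'' means $\lim_{t\searrow0}\hat u(t)=b$. Let fixings $(\tau_j,c_j)\in[0,T)\times\{0,1\}$, $j=1,\dots,N$, with $\tau_1<\cdots<\tau_N$ be given and set $$D(\sigma)_{\rm SP}:=\{u\in D(\sigma):\ u(\tau_j)=c_j\ \text{for all } j=1,\ldots,N\}.$$ $\overline{D(\sigma)_{\rm SP}}$ is its closure in $L^p(0,T)$. Let $I_i=(a_i,b_i)\subseteq(0,T)$, $i=1,\ldots,M$, be nonempty, pairwise disjoint open intervals with $\tau_j\notin I_i$ for all $i,j$, and let $\Pi$ be the local averaging operator $$\Pi(u)=\Big(\tfrac{1}{\lambda(I_i)}\int_{I_i}u(t)\,\mathrm{d}t\Big)_{i=1}^M\in\mathbb{R}^M,$$ where $\lambda(I_i)=b_i-a_i$ is the length of $I_i$.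 *)

(* Defs.v *)
From HB Require Import structures.
From mathcomp Require Import all_boot all_order all_algebra.
From mathcomp Require Import all_classical all_reals all_analysis.

Set Implicit Arguments.
Unset Strict Implicit.
Unset Printing Implicit Defensive.
Import Order.TTheory GRing.Theory Num.Theory.
Import numFieldNormedType.Exports.

Local Open Scope classical_set_scope.
Local Open Scope ring_scope.

(* Elements of L^p(0,T) and BV(0,T) are represented by Borel functions u : R -> R,
   all notions below depending on u only up to equality a.e. on ]0, T[
   (extending by zero, every class has a representative of this form). *)

Section BV.
Context {R : realType}.
Implicit Types (T sigma p : R) (u v phi : R -> R).

Definition lebesgue_on T : {measure set (measurableTypeR R) -> \bar R} :=
  mrestr lebesgue_measure (measurable_itv `]0, T[).

(* C^1 functions on ]0, T[ with compact support, extended by 0 to R *)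
Definition C1c T phi : Prop :=
  [/\ forall x, derivable phi x 1, continuous (derive1 phi)
    & exists s t, [/\ 0 < s, t < T & forall x, x \notin `[s, t] -> phi x = 0]].

(* |u|_{BV(0,T)}, the total mass of the distributional derivative of u; the
   integrals are finite for u in L^1(0,T) *)
Definition BV_seminorm T u : \bar R :=
  ereal_sup [set (\int[lebesgue_measure]_(x in `]0%R, T[) (u x * derive1 phi x)%:E)%E
            | phi in [set phi | C1c T phi /\ forall x, `|phi x| <= 1]].

Definition BV T u : Prop :=
  u \in Lfun (lebesgue_on T) 1%E /\ (BV_seminorm T u < +oo)%E.

Definition D_sigma T sigma : set (R -> R) :=
  [set u | [/\ BV T u,
    {ae lebesgue_measure, forall t : R, t \in `]0, T[ -> u t = 0 \/ u t = 1}
    & (BV_seminorm T u <= sigma%:E)%E]].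

Definition rc_representative T u v : Prop :=
  {ae lebesgue_measure, forall t : R, t \in `]0, T[ -> v t = u t} /\
  forall t, t \in `]0, T[ -> v x @[x --> t^'+] --> v t.

(* u(t) = y for t in [0, T[ ; the representative v is unique on ]0, T[ *)
Definition has_value T u (t y : R) : Prop :=
  exists2 v, rc_representative T u v &
    if t == 0 then v x @[x --> 0^'+] --> y else v t = y.

Definition D_SP T sigma N (tau : 'I_N -> R) (c : 'I_N -> bool) : set (R -> R) :=
  [set u | D_sigma T sigma u /\ forall j, has_value T u (tau j) (c j)%:R].

Definition Lp_closure T p (A : set (R -> R)) : set (R -> R) :=
  [set u | u \in Lfun (lebesgue_on T) p%:E /\
    forall e : R, 0 < e ->
      exists2 v, A v & ('N[lebesgue_on T]_p%:E[EFin \o (u \- v)%R] < e%:E)%E].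

Definition local_average M (a b : 'I_M -> R) u : 'rV[R]_M :=
  \row_i ((b i - a i)^-1 * \int[lebesgue_measure]_(t in `]a i, b i[) u t).

End BV.

Definition convex_hull {R : realType} {E : lmodType R} (A : set E) : set E :=
  smallest (@convex_set R E) A.

Definition zero_one_polytope {R : realType} {M : nat} (C : set 'rV[R]_M) : Prop :=
  exists2 V : set 'rV[R]_M,
    (forall v, V v -> forall i, v ord0 i = 0 \/ v ord0 i = 1) & C = convex_hull V.

(* Main.v *)
(* Every [u] in [D_sigma] has a right-continuous 0/1 representative [g] on ]0, T[
   of pointwise variation at most [sigma]: testing the distributional derivative
   against sums of smoothed steps located at Lebesgue points bounds the variation
   along these points, hence [u] has one-sided limits along them.  Conversely a
   right-continuous 0/1 function of variation at most [sigma] is in [D_sigma], by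
   summation by parts on uniform grids.

   Choose [s_i] in each [I_i] and precompose [g] with the monotone map that sends
   [[a_i + d, b_i[] to [s_i] and fixes every other point: the variation does not
   increase and the values at the [tau_j] are kept, because [tau_j] is not in
   [I_i].  As [d] tends to 0 this shows that the function equal to [g s_i] on
   [I_i] and to [g] elsewhere is in the closure.  Its averages are the 0/1 vector
   [(g s_i)_i].  Every 0/1 vector that agrees with the average of [g] in the
   coordinates where that average is 0 or 1 arises this way, and these vectors
   span a face of the cube containing the average of [g].  If [g] is close enough
   to an element [u] of the closure, the vertices obtained include those of the
   smallest face containing the average of [u], so no compactness is needed. *)
Require Import Defs.
From mathcomp Require Import all_boot all_order all_algebra.
From mathcomp Require Import all_classical all_reals all_analysis.
From mathcomp Require Import measurable_realfun ring lra.
Set Implicit Arguments.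
Unset Strict Implicit.
Unset Printing Implicit Defensive.
Import Order.TTheory GRing.Theory Num.Theory.
Import numFieldNormedType.Exports.
Local Open Scope classical_set_scope.
Local Open Scope ring_scope.

(** * Integrals over ]0, T[ *)

Section Lebesgue_on.
Context {R : realType}.
Implicit Types (T p : R) (f g u v : R -> R).
Local Notation mu := (@lebesgue_measure R).

Lemma measurable_itvR (i : interval R) :
  measurable ([set` i] : set (measurableTypeR R)).
Proof. exact: measurable_itv. Qed.
Hint Resolve measurable_itvR : core.

Lemma lebesgue_onC T : lebesgue_on T (~` `]0, T[) = 0%E.
Proof. by rewrite /lebesgue_on/= /mrestr setICl measure0. Qed.

(** The complement of []0, T[] has mass zero for [lebesgue_on T], and on subsets of []0, T[] the two
    measures agree. *)
Lemma ge0_integral_lebesgue_on T (F : R -> \bar R) :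
  measurable_fun setT F -> (forall x, (0 <= F x)%E) ->
  (\int[lebesgue_on T]_x F x = \int[mu]_(x in `]0%R, T[) F x)%E.
Proof.
move=> mF F0.
have mC : measurable (~` `]0, T[ : set (measurableTypeR R)).
  by apply: measurableC; exact: measurable_itvR.
have := ge0_negligible_integral mC measurableT mF (fun x _ => F0 x)
  (lebesgue_onC T).
rewrite setDE setCK setTI => ->; apply: eq_measure_integral => A mA AD.
by rewrite /lebesgue_on/= /mrestr setIidl.
Qed.

Lemma lebesgue_on_fin_num T : lebesgue_on T setT \is a fin_num.
Proof.
rewrite /lebesgue_on/= /mrestr setTI lebesgue_measure_itv.
by case: ifP.
Qed.

Lemma integrable_lebesgue_on T f : measurable_fun setT f ->
  (lebesgue_on T).-integrable setT (EFin \o f) <->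
  mu.-integrable `]0, T[ (EFin \o f).
Proof.
move=> mf.
have mEf : measurable_fun setT (EFin \o f) by exact/measurable_EFinP.
have E : (\int[lebesgue_on T]_x `|(EFin \o f) x| =
          \int[mu]_(x in `]0%R, T[) `|(EFin \o f) x|)%E.
  by apply: ge0_integral_lebesgue_on => //; exact: measurableT_comp.
split=> /integrableP[_ h]; apply/integrableP; split=> //.
- exact: measurable_funTS.
- by rewrite -E.
- by rewrite E.
Qed.

Lemma Lfun1_itv T f : f \in Lfun (lebesgue_on T) 1%E <->
  measurable_fun setT f /\ mu.-integrable `]0, T[ (EFin \o f).
Proof.
split.
  move=> fL; have [mf] : measurable_fun setT f /\ true.
    by move: fL; rewrite inE => /andP[/[1!inE]/= mf _].
  split=> //; apply/integrable_lebesgue_on => //; exact/Lfun1_integrable.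
by move=> [mf fi]; apply/Lfun1_integrable/integrable_lebesgue_on.
Qed.

Lemma Lfun_Lfun1 T p f : 1 <= p ->
  f \in Lfun (lebesgue_on T) p%:E -> f \in Lfun (lebesgue_on T) 1%E.
Proof.
by move=> p1; apply: Lfun_subset; rewrite ?lee_fin ?lebesgue_on_fin_num.
Qed.

Lemma integrable_itv_bounded (i j : R) f (c : R) :
  measurable_fun `]i, j[ f -> (forall x, x \in `]i, j[ -> `|f x| <= c) ->
  mu.-integrable `]i, j[ (EFin \o f).
Proof.
move=> mf fc; apply: (@le_integrable _ _ _ mu _ _ _ (EFin \o cst `|c|)) => //.
- exact/measurable_EFinP.
- move=> x /= xij; rewrite lee_fin normr_id (le_trans (fc x xij))//.
  exact: ler_norm.
- apply/integrableP; split; first exact/measurable_EFinP.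
  rewrite (integral_cst mu (measurable_itvR _) `| `|c|%:E |%E) /= lebesgue_measure_itv/=.
  by case: ifP => _; rewrite ?mule0// -EFinB -EFinM ltry.
Qed.

Lemma LnormE_itv T p f : 1 <= p -> measurable_fun setT f ->
  ('N[lebesgue_on T]_p%:E[EFin \o f] =
   (\int[mu]_(x in `]0%R, T[) (`|f x| `^ p)%:E) `^ p^-1)%E.
Proof.
move=> p1 mf; rewrite unlock; congr (_ `^ _)%E.
rewrite /=; apply: ge0_integral_lebesgue_on => [|x]; last by rewrite lee_fin powR_ge0.
apply/measurable_EFinP.
apply: (@measurableT_comp _ _ _ _ _ _ (@powR R ^~ p)) => //.
exact: measurableT_comp.
Qed.

Lemma Lfun_bounded T p f (c : R) : 1 <= p -> measurable_fun setT f ->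
  (forall x, `|f x| <= c) -> f \in Lfun (lebesgue_on T) p%:E.
Proof.
move=> p1 mf fc; rewrite inE; apply/andP; split; rewrite inE//=.
rewrite /finite_norm LnormE_itv//; apply: poweR_lty.
have c0 : 0 <= c by apply: le_trans (fc 0).
have mp : measurable_fun setT (fun x => `|f x| `^ p).
  apply: (@measurableT_comp _ _ _ _ _ _ (@powR R ^~ p)) => //.
  exact: measurableT_comp.
have := @integrable_itv_bounded 0 T _ (c `^ p) (measurable_funTS mp).
move=> /(_ _)/integrableP[]//.
  move=> x _; rewrite ger0_norm ?powR_ge0// ge0_ler_powR// ?nnegrE//.
  exact: le_trans p1.
move=> _; under eq_integral do rewrite /= ger0_norm ?powR_ge0//.
by [].
Qed.

(* From [t <= eta + eta `^ (1 - p) * t `^ p] for [0 <= t]. *)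
Lemma L1_le_Lnorm T p f (eta : R) : 0 <= T -> 1 <= p -> 0 < eta ->
  measurable_fun setT f -> ('N[lebesgue_on T]_p%:E[EFin \o f] < eta%:E)%E ->
  (\int[mu]_(x in `]0%R, T[) (`|f x|)%:E <= (eta * (T + 1))%:E)%E.
Proof.
move=> T0 p1 eta0 mf; rewrite LnormE_itv// => hN.
have p0 : 0 < p by apply: lt_le_trans p1.
have mp : measurable_fun setT (fun x => `|f x| `^ p).
  apply: (@measurableT_comp _ _ _ _ _ _ (@powR R ^~ p)) => //.
  exact: measurableT_comp.
set I := (\int[mu]_(x in _) _)%E in hN.
have I0 : (0 <= I)%E by apply: integral_ge0 => x _; rewrite lee_fin powR_ge0.
have hI : (I <= (eta `^ p)%:E)%E.
  have : ((I `^ p^-1) `^ p <= (eta%:E) `^ p)%E.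
    apply: gt0_ler_poweR; rewrite ?(ltW p0)// ?in_itv/= ?poweR_ge0 ?leey ?lee_fin ?(ltW eta0)//.
    exact: ltW.
  by rewrite -poweRrM mulVf ?gt_eqF// poweRe1//.
apply: (@le_trans _ _ (\int[mu]_(x in `]0%R, T[)
   (eta%:E + (eta `^ (1 - p))%:E * (`|f x| `^ p)%:E))%E).
  apply: ge0_le_integral => //.
  - apply/measurable_EFinP; apply: measurable_funTS; exact: measurableT_comp.
  - apply/measurable_EFinP; apply: measurable_funD => //.
    by apply: measurable_funM => //; exact: measurable_funTS.
  (* Values up to [eta] are absorbed by the first summand. Beyond [eta], write [t] as
     [t^(1-p) * t^p]; since [1 - p <= 0], the first factor is at most [eta^(1-p)]. *)
  - move=> x _; rewrite -EFinM -EFinD lee_fin.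
    have [fe|ef] := leP `|f x| eta.
      by rewrite (le_trans fe)// lerDl mulr_ge0// powR_ge0.
    have f0 : 0 < `|f x| by apply: lt_trans ef.
    rewrite -[leLHS]add0r lerD ?(ltW eta0)//.
    rewrite -[leLHS]powRr1//.
    rewrite -{1}(subrK p 1) powRD; last by rewrite (gt_eqF f0) implybT.
    rewrite ler_wpM2r ?powR_ge0//.
    rewrite -[1 - p]opprB !powRN lef_pV2 ?posrE ?powR_gt0//.
    by rewrite ge0_ler_powR ?nnegrE ?subr_ge0// ltW.
rewrite ge0_integralD//; last 3 first.
- by move=> x _; rewrite lee_fin ltW.
- by move=> x _; rewrite -EFinM lee_fin mulr_ge0 ?powR_ge0.
- apply/measurable_EFinP; apply: measurable_funM => //; exact: measurable_funTS.
rewrite integral_cst// ge0_integralZl//; last 2 first.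
- by apply/measurable_EFinP; exact: measurable_funTS.
- by rewrite lee_fin powR_ge0.
rewrite mulrDr mulr1 EFinD; apply: leeD.
  rewrite EFinM lee_pmul2l//= lebesgue_measure_itv/=; case: ifP => _.
    by rewrite -EFinD subr0.
  by rewrite lee_fin.
apply: (@le_trans _ _ ((eta `^ (1 - p))%:E * (eta `^ p)%:E)%E).
  by rewrite lee_pmul2l// lte_fin powR_gt0.
rewrite -EFinM -powRD; last by rewrite (gt_eqF eta0) implybT.
by rewrite subrK powRr1// ltW.
Qed.

Lemma ae_mono2 (P Q S : R -> Prop) : (forall x, P x -> Q x -> S x) ->
  {ae mu, forall x, P x} -> {ae mu, forall x, Q x} -> {ae mu, forall x, S x}.
Proof. exact: (@filterS2 _ _ (ae_filter_ringOfSetsType mu)). Qed.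

Lemma ae_mono (P S : R -> Prop) : (forall x, P x -> S x) ->
  {ae mu, forall x, P x} -> {ae mu, forall x, S x}.
Proof. exact: (@filterS _ _ (ae_filter_ringOfSetsType mu)). Qed.

(** A nonempty open interval has positive measure, so it is not contained in a null set. *)
Lemma ae_meets_itv (P : R -> Prop) (i j : R) : i < j ->
  {ae mu, forall x, P x} -> exists2 x, x \in `]i, j[ & P x.
Proof.
move=> ij [A [mA A0 sA]]; apply: contrapT => nex.
have sub : `]i, j[ `<=` A.
  by move=> x /= xij; apply: sA => /= Px; apply: nex; exists x.
have : (mu `]i, j[%classic <= mu A)%E by apply: le_measure => //; rewrite inE.
rewrite A0 lebesgue_measure_itv/= lte_fin ij -EFinD lee_fin subr_le0 leNgt.
by rewrite ij.
Qed.

End Lebesgue_on.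
#[global] Hint Resolve measurable_itvR : core.

(** * Smoothed steps and pointwise variation *)

Section Ramp.
Context {R : realType}.
Implicit Types (e x y z : R).

Definition sqrp x : R := Num.max x 0 ^+ 2.

Lemma is_derive_sqrp x : is_derive x (1 : R) sqrp (2 * Num.max x 0).
Proof.
(* A quadratic remainder bound, uniform in [x], gives the derivative also at the kink 0. *)
have key h : `|sqrp (h + x) - sqrp x - 2 * Num.max x 0 * h| <= h ^+ 2.
  rewrite ler_norml /sqrp !maxEle; apply/andP; split;
    case: (leP (h + x) 0); case: (leP x 0) => ? ?; nra.
have H : h^-1 *: (sqrp (h *: (1 : R) + x) - sqrp x) @[h --> (0 : R)^'] -->
    2 * Num.max x 0.
  apply/cvgrPdist_le => /= eps eps0; near=> h.
  have h0 : h != 0 by near: h; exact: nbhs_dnbhs_neq.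
  have he : `|h| <= eps.
    by near: h; apply: dnbhs0_le.
  rewrite /GRing.scale/= mulr1 distrC; apply: le_trans he.
  rewrite -[2 * _](mulKf h0) -mulrBr normrM normfV ler_pdivrMl ?normr_gt0//.
  rewrite -expr2 real_normK ?num_real// (le_trans _ (key h))//.
  by rewrite (mulrC h).
have cH : cvg (h^-1 *: (sqrp (h *: (1 : R) + x) - sqrp x) @[h --> (0 : R)^']).
  by apply/cvg_ex; exists (2 * Num.max x 0).
apply: DeriveDef; first exact: cH.
by rewrite /derive; apply/cvg_lim.
Unshelve. all: by end_near. Qed.

(* The quadratic spline rising from 0 to 1 on [[0, e]]; its derivative [tent e]
   is continuous, of integral 1 and supported in [[0, e]]. *)
Definition ramp e z : R :=
  2 * (sqrp (z / e) - 2 * sqrp (z / e - 2^-1) + sqrp (z / e - 1)).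

Definition tent e z : R :=
  4 / e * (Num.max (z / e) 0 - 2 * Num.max (z / e - 2^-1) 0
           + Num.max (z / e - 1) 0).

Lemma is_derive_sqrp_affine e c z :
  is_derive z (1 : R) (fun z => sqrp (z / e - c))
    (2 * Num.max (z / e - c) 0 / e).
Proof.
have d : is_derive z (1 : R) (fun z => z / e - c) e^-1.
  rewrite -[X in is_derive _ _ _ X]subr0 -[X in X - 0]mul1r.
  rewrite (_ : (fun z => z / e - c) = (e^-1 *: id) - cst c); last first.
    by apply/funext => t; rewrite /= !fctE /GRing.scale/= mulrC.
  by apply: is_derive_eq; rewrite /GRing.scale/= mulr1 mul1r.
have := @is_derive1_comp _ sqrp (fun z => z / e - c) z _ _
  (is_derive_sqrp (z / e - c)) d.
by [].
Qed.

Lemma is_derive_ramp e z : is_derive z (1 : R) (ramp e) (tent e z).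
Proof.
have d0 := is_derive_sqrp_affine e 0 z.
have d1 := is_derive_sqrp_affine e 2^-1 z.
have d2 := is_derive_sqrp_affine e 1 z.
rewrite (_ : ramp e = 2 *: ((fun z => sqrp (z / e - 0)) -
    2 *: (fun z => sqrp (z / e - 2^-1)) + (fun z => sqrp (z / e - 1)))).
  apply: is_derive_eq; rewrite /tent /GRing.scale/= subr0; ring.
by apply/funext => t; rewrite /ramp !fctE /GRing.scale/= subr0.
Qed.

Lemma tent_bounds e z : 0 < e -> 0 <= tent e z <= 2 / e.
Proof.
move=> e0; have ei : 0 < e^-1 by rewrite invr_gt0.
rewrite /tent; set y := z / e; set K := (_ + _).
(* [K] is the hat function of [y] on [[0, 1]], whose peak [2^-1] is reached at [y = 2^-1]. *)
have [K0 K1] : 0 <= K /\ K <= 2^-1.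
  by rewrite /K !maxEle; case: (leP y 0) => ?; case: (leP (y - 2^-1) 0) => ?;
    case: (leP (y - 1) 0) => ?; split; lra.
apply/andP; split; nra.
Qed.

Lemma tent_eq0 e z : 0 < e -> z <= 0 \/ e <= z -> tent e z = 0.
Proof.
move=> e0 ze; have [yz|yz] : z / e <= 0 \/ 1 <= z / e.
- by case: ze => h; [left; rewrite pmulr_lle0 ?invr_gt0|right; rewrite ler_pdivlMr ?mul1r].
- rewrite /tent !max_r; lra.
- rewrite /tent !max_l; lra.
Qed.

Lemma ramp_eq0 e z : 0 < e -> z <= 0 -> ramp e z = 0.
Proof.
move=> e0 z0; have yz : z / e <= 0 by rewrite pmulr_lle0 ?invr_gt0.
by rewrite /ramp /sqrp !max_r; lra.
Qed.

Lemma ramp_eq1 e z : 0 < e -> e <= z -> ramp e z = 1.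
Proof.
move=> e0 z0; have yz : 1 <= z / e by rewrite ler_pdivlMr ?mul1r.
by rewrite /ramp /sqrp !max_l; try lra; field; rewrite gt_eqF.
Qed.

Lemma ramp_homo e : 0 < e -> {homo ramp e : x y / x <= y}.
Proof.
move=> e0 x y xy.
apply: (@ger0_derive1_ndecr _ (ramp e) x y) => //.
- by move=> z _; have [] := is_derive_ramp e z.
- move=> z _; rewrite derive1E (derive_val (is_derive := is_derive_ramp e z)).
  by have /andP[] := tent_bounds z e0.
- apply: derivable_within_continuous => z _.
  by have [] := is_derive_ramp e z.
Qed.

Lemma ramp_itv e z : 0 < e -> 0 <= ramp e z <= 1.
Proof.
move=> e0; apply/andP; split.
  have [z0|z0] := leP z 0; first by rewrite ramp_eq0.
  by rewrite -(ramp_eq0 e0 (lexx 0)) ramp_homo// ltW.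
have [z0|z0] := leP e z; first by rewrite ramp_eq1.
by rewrite -(ramp_eq1 e0 (lexx e)) ramp_homo// ltW.
Qed.

Lemma continuous_tent e : continuous (tent e).
Proof.
have ca c : continuous (fun z : R => Num.max (z / e - c) 0).
  move=> z; apply: (@continuous_max _ _ (fun z => z / e - c) (cst 0)).
    by apply: cvgB; [apply: cvgMl; exact: cvg_id|exact: cvg_cst].
  exact: cvg_cst.
move=> z; rewrite (_ : tent e = (fun z => 4 / e * (Num.max (z / e - 0) 0
  - 2 * Num.max (z / e - 2^-1) 0 + Num.max (z / e - 1) 0))).
  apply: cvgMr; apply: cvgD; last exact: ca.
  by apply: cvgB; [exact: ca|apply: cvgMr; exact: ca].
by apply/funext => t; rewrite /tent subr0.
Qed.

End Ramp.

Section Variation.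
Context {R : realType}.
Implicit Types (f g h : R -> R) (x y z e : R) (s : seq R).

(** The first point is kept apart from the list, as in [path], so that [path <=%R x s] says that the
    points are ordered. *)
Fixpoint vsum f x s : R :=
  if s is y :: s' then `|f y - f x| + vsum f y s' else 0.

(* With [g = f] this is [vsum f]: the signs make the increments of [f] positive. *)
Fixpoint wsum f g x s : R :=
  if s is y :: s' then Num.sg (f x - f y) * (g x - g y) + wsum f g y s' else 0.

Lemma wsum_id f x s : wsum f f x s = vsum f x s.
Proof. by elim: s x => //= y s IH x; rewrite IH -normrEsg distrC. Qed.

Lemma eq_vsum f g x s : f x = g x -> {in s, f =1 g} -> vsum f x s = vsum g x s.
Proof.
elim: s x => //= y s IH x fx fs.
rewrite fx !(fs y) ?mem_head// IH ?fs ?mem_head// => z zs.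
by rewrite fs// in_cons zs orbT.
Qed.

Lemma vsum_map f (h : R -> R) x s :
  vsum f (h x) (map h s) = vsum (f \o h) x s.
Proof. by elim: s x => //= y s IH x; rewrite IH. Qed.

Lemma sg_le1 x : `|Num.sg x| <= 1 :> R.
Proof. by rewrite normr_sg; case: (x != 0) => /=; rewrite ?lexx ?ler01. Qed.

(** Bounding the signs by 1 makes the sum telescope. This bounds by 1 the test functions assembled
    from ramps and locates their support. *)
Lemma wsum_homo f g x s : {homo g : x y /~ x <= y} -> path <=%R x s ->
  `|wsum f g x s| <= g x - g (last x s).
Proof.
move=> gh; elim: s x => [|y s IH] x /=; first by rewrite normr0 subrr.
move=> /andP[xy ys]; apply: (le_trans (ler_normD _ _)).
rewrite -[leRHS](subrKA (g y)) lerD ?IH// normrM (ger0_norm (_ : 0 <= g x - g y)).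
  by rewrite ler_piMl ?sg_le1// subr_ge0 gh.
by rewrite subr_ge0 gh.
Qed.

End Variation.

Section Wsum_calculus.
Context {R : realType}.
Implicit Types (f g u : R -> R) (x y z e : R) (s : seq R).
Local Notation mu := (@lebesgue_measure R).

(** Once [f] has fixed the signs, [wsum] is linear in its second argument, hence commutes with
    derivatives, and likewise with limits and integrals below. *)
Lemma is_derive_wsum f (G dG : R -> R -> R) x s z :
  (forall y, is_derive z (1 : R) (G ^~ y) (dG z y)) ->
  is_derive z (1 : R) (fun z => wsum f (G z) x s) (wsum f (dG z) x s).
Proof.
move=> dGP; elim: s x => [|y s IH] x /=; first exact: is_derive_cst.
have dx := dGP x; have dy := dGP y; have ds := IH y.
rewrite (_ : (fun z => _) = Num.sg (f x - f y) *: (G ^~ x - G ^~ y) +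
   (fun z => wsum f (G z) y s)); first exact: is_derive_eq.
by apply/funext => t.
Qed.

Lemma cvg_wsum (I : Type) (F : set_system I) {FF : Filter F} f
    (G : I -> R -> R) g x s :
  {in x :: s, forall y, G i y @[i --> F] --> g y} ->
  wsum f (G i) x s @[i --> F] --> wsum f g x s.
Proof.
elim: s x => [|y s IH] x /= Gg; first exact: cvg_cst.
apply: cvgD; last by apply: IH => t ts; apply: Gg; rewrite in_cons ts orbT.
apply: cvgMr; apply: cvgB; apply: Gg; by rewrite !in_cons eqxx ?orbT /= ?orbT.
Qed.

Lemma integrable_mul_bounded (D : set (measurableTypeR R)) u f (c : R) : measurable D ->
  mu.-integrable D (EFin \o u) -> measurable_fun D f ->
  (forall x, `|f x| <= c) -> mu.-integrable D (EFin \o (u \* f)).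
Proof.
move=> mD ui mf fc.
apply: (@le_integrable _ _ _ mu _ mD _ (fun x => c%:E * (EFin \o u) x)%E).
- apply/measurable_EFinP; apply: measurable_funM => //.
  by apply/measurable_EFinP; exact: measurable_int ui.
- move=> x _ /=; rewrite lee_fin !normrM mulrC ler_wpM2r//.
  by rewrite (le_trans (fc x))// ler_norm.
- exact: integrableZl.
Qed.

Lemma Rintegral_wsum (D : set (measurableTypeR R)) u f (k : R -> R -> R) x s : measurable D ->
  (forall y, mu.-integrable D (EFin \o (fun z => u z * k z y))) ->
  mu.-integrable D (EFin \o (fun z => u z * wsum f (k z) x s)) /\
  \int[mu]_(z in D) (u z * wsum f (k z) x s) =
  wsum f (fun y => \int[mu]_(z in D) (u z * k z y)) x s.
Proof.
move=> mD ki; elim: s x => [|y s IH] x /=.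
  under [in X in _ /\ X]eq_Rintegral do rewrite mulr0.
  rewrite (_ : _ \o _ = cst 0%E); last first.
    by apply/funext => z; rewrite /= mulr0.
  split; first exact: integrable0.
  by rewrite /Rintegral integral0.
have [IHi IHe] := IH y; set c := Num.sg _.
have i1 : mu.-integrable D (EFin \o (fun z => u z * k z x - u z * k z y)).
  apply: (eq_integrable mD _ _ _ (integrableB mD (ki x) (ki y))) => z _.
  by rewrite /= EFinB.
have i2 : mu.-integrable D (EFin \o (fun z => c * (u z * k z x - u z * k z y))).
  exact: (eq_integrable mD _ _ _ (integrableZl mD c i1)).
rewrite (_ : (fun z => _) = (fun z => c * (u z * k z x - u z * k z y) +
   u z * wsum f (k z) y s)); last by apply/funext => z; ring.
split; first exact: (eq_integrable mD _ _ _ (integrableD mD i2 IHi)).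
by rewrite RintegralD// IHe RintegralZl// RintegralB.
Qed.

End Wsum_calculus.

(** * Testing the distributional derivative near Lebesgue points *)

Section Variation_at_Lebesgue_points.
Context {R : realType}.
Implicit Types (T sigma x y z e : R) (u f : R -> R) (s : seq R).
Local Notation mu := (@lebesgue_measure R).

(** A one-sided mollification: the kernel lives on [[x, x + e]], so only values of [u] to the right
    of [x] count. *)
Definition tentconv T u e x : R := \int[mu]_(z in `]0, T[) (u z * tent e (z - x)).

Lemma continuous_tent_shift e x : continuous (fun z : R => tent e (z - x)).
Proof.
move=> z; apply: (@continuous_comp _ _ _ (fun z => z - x) (tent e)).
  by apply: cvgB; [exact: cvg_id|exact: cvg_cst].
exact: continuous_tent.
Qed.

Lemma is_derive_ramp_shift e x z :
  is_derive z (1 : R) (fun z => ramp e (z - x)) (tent e (z - x)).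
Proof.
have d : is_derive z (1 : R) (fun z : R => z - x) 1.
  rewrite (_ : (fun z => z - x) = id - cst x)//.
  by apply: is_derive_eq; rewrite subr0.
have := @is_derive1_comp _ (ramp e) (fun z => z - x) z _ _
  (is_derive_ramp e (z - x)) d.
by rewrite mulr1.
Qed.

Lemma tent_shift_bounded e x z : 0 < e -> `|tent e (z - x)| <= 2 / e.
Proof.
by move=> e0; have /andP[t0 t1] := tent_bounds (z - x) e0; rewrite ger0_norm.
Qed.

Lemma integrable_tent T u e x : 0 < e -> mu.-integrable `]0, T[ (EFin \o u) ->
  mu.-integrable `]0, T[ (EFin \o (fun z => u z * tent e (z - x))).
Proof.
move=> e0 ui; apply: (integrable_mul_bounded (c := 2 / e)) => //.
  apply: measurable_funTS; apply: continuous_measurable_fun.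
  exact: continuous_tent_shift.
by move=> z; exact: tent_shift_bounded.
Qed.

(** The left-hand side is the integral of [u] against the derivative of [phi], a signed sum of ramps
    starting at the given points, and [phi] is admissible in the definition of [BV_seminorm]. *)
Lemma wsum_tentconv_le T u sigma e x s : 0 < e -> 0 < x ->
  path <=%R x s -> last x s + e < T ->
  mu.-integrable `]0, T[ (EFin \o u) -> (BV_seminorm T u <= sigma%:E)%E ->
  wsum u (tentconv T u e) x s <= sigma.
Proof.
move=> e0 x0 xs sT ui us.
pose phi z := wsum u (fun y => ramp e (z - y)) x s.
have dphi z : is_derive z (1 : R) phi (wsum u (fun y => tent e (z - y)) x s).
  apply: (@is_derive_wsum _ _ (fun z y => ramp e (z - y))
    (fun z y => tent e (z - y))) => y.
  exact: is_derive_ramp_shift.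
have dphiE : derive1 phi = fun z => wsum u (fun y => tent e (z - y)) x s.
  apply/funext => z; rewrite derive1E.
  by rewrite (derive_val (is_derive := dphi z)).
have rh z : {homo (fun y => ramp e (z - y)) : a b /~ a <= b}.
  by move=> a b ab; rewrite ramp_homo// lerB.
have phi_le z := wsum_homo u (rh z) xs.
have phi1 z : `|phi z| <= 1.
  apply: (le_trans (phi_le z)).
  have /andP[_ r1] := ramp_itv (z - x) e0.
  have /andP[r0 _] := ramp_itv (z - last x s) e0.
  by rewrite lerBlDr (le_trans r1)// lerDl.
have phiC : C1c T phi.
  split=> [z||].
  - by have [] := dphi z.
  - rewrite dphiE => z; apply: cvg_wsum => y _; exact: continuous_tent_shift.
  - exists x, (last x s + e); split=> // z.
    rewrite in_itv/= negb_and -!ltNge => /orP zx.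
    (* Outside [[x, last x s + e]] the ramps starting at the first and at the last point are both 0
       or both 1, so the telescoped bound [phi_le] vanishes. *)
    apply/eqP; rewrite -normr_eq0 eq_le normr_ge0 andbT.
    apply: (le_trans (phi_le z)).
    have xl : x <= last x s.
      case: s xs {sT phi dphi dphiE phi_le phi1 zx us} => [|y s] //.
      move=> /(order_path_min le_trans)/allP xle; exact: (xle _ (mem_last y s)).
    case: zx => zx.
      by rewrite !ramp_eq0 ?subrr// subr_le0 ?(le_trans (ltW zx))// ltW.
    by rewrite !ramp_eq1 ?subrr//; lra.
have [ii ie] := Rintegral_wsum u x s (measurable_itvR `]0, T[)
  (fun y => integrable_tent y e0 ui).
rewrite -[leLHS]ie -lee_fin; apply: le_trans us; apply: ereal_sup_ubound.
exists phi; first by [].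
by rewrite dphiE [in RHS]/Rintegral fineK//; exact: integrable_fin_num ii.
Qed.

Lemma Rintegral_tent T e x : 0 < e -> 0 < x -> x + e < T ->
  \int[mu]_(z in `]0, T[) tent e (z - x) = 1.
Proof.
move=> e0 x0 xT; have T0 : 0 < T by lra.
rewrite /Rintegral -(@integral_itv_bndoo _ _ _ _ true false); last first.
  apply/measurable_EFinP; apply: measurable_funTS.
  by apply: continuous_measurable_fun; exact: continuous_tent_shift.
rewrite (@continuous_FTC2 _ _ (fun z => ramp e (z - x)))//.
- rewrite ramp_eq1//; last lra.
  by rewrite ramp_eq0//; [rewrite sube0|lra].
- exact/continuous_subspaceT/continuous_tent_shift.
- have dr z : derivable (fun z => ramp e (z - x)) z (1 : R).
    by have [] := is_derive_ramp_shift e x z.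
  have cr z : {for z, continuous (fun z => ramp e (z - x))}.
    exact/differentiable_continuous/derivable1_diffP.
  split=> [z _||].
  + exact: dr.
  + by apply: cvg_at_right_filter; exact: cr.
  + by apply: cvg_at_left_filter; exact: cr.
- move=> z _; rewrite derive1E.
  by rewrite (derive_val (is_derive := is_derive_ramp_shift e x z)).
Qed.

(** The kernel has integral 1, is at most [2 / e] and vanishes outside the ball of radius [e], whose
    measure is [2 * e]. Hence the error is at most 4 times the mean deviation [davg] over that ball,
    which tends to 0 at a Lebesgue point. *)
Lemma tentconv_cvg T u x : 0 < x < T -> mu.-integrable `]0, T[ (EFin \o u) ->
  lebesgue_pt (u \_ `]0, T[) x -> tentconv T u e x @[e --> 0^'+] --> u x.
Proof.
move=> /andP[x0 xT] ui; rewrite /lebesgue_pt => L.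
set f := u \_ _ in L.
have fx : f x = u x by rewrite /f patchE mem_set//= in_itv/= x0.
have L4 : (4 * fine (davg f x e))%R @[e --> 0^'+] --> (0 : R).
  by rewrite -[X in _ --> X](mulr0 4); apply: cvgMr; exact: fine_cvg.
apply/cvgrPdist_le => eps eps0.
have [_ /cvgrPdist_le/(_ _ eps0) L4'] := (I, L4).
near=> e.
have e0 : 0 < e by [].
have xe0 : 0 < x - e by rewrite subr_gt0; near: e; exact: nbhs_right_lt.
have xeT : x + e < T.
  by rewrite -ltrBrDl; near: e; apply: nbhs_right_lt; rewrite subr_gt0.
have : `|0 - 4 * fine (davg f x e)| <= eps by near: e.
rewrite sub0r normrN => h; apply: le_trans h.
have t_int : mu.-integrable `]0, T[ (EFin \o (fun z => tent e (z - x))).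
  apply: (integrable_itv_bounded (c := 2 / e)).
    apply: measurable_funTS; apply: continuous_measurable_fun.
    exact: continuous_tent_shift.
  by move=> z _; exact: tent_shift_bounded.
have uxt_int : mu.-integrable `]0, T[ (EFin \o (fun z => u x * tent e (z - x))).
  exact: (eq_integrable (measurable_itvR _) _ _ _
    (integrableZl (measurable_itvR _) (u x) t_int)).
rewrite -[X in X - _]mulr1 -[X in _ * X - _](Rintegral_tent e0 x0 xeT).
rewrite -RintegralZl//.
rewrite -RintegralB//; last exact: integrable_tent.
pose g z := u x * tent e (z - x) - u z * tent e (z - x).
have g_int : mu.-integrable `]0, T[ (EFin \o g).
  exact: (eq_integrable (measurable_itvR _) _ _ _
    (integrableB (measurable_itvR _) uxt_int (integrable_tent x e0 ui))).
apply: (le_trans (le_normr_Rintegral (measurable_itvR _) g_int)).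
have bD : ball x e `<=` `]0, T[.
  by move=> z; rewrite ball_itv/= !in_itv/=; lra.
have mb : measurable (ball x e : set (measurableTypeR R)).
  by rewrite ball_itv; exact: measurable_itvR.
have fi : mu.-integrable (ball x e) (EFin \o (fun z => f z - f x)).
  have ub : mu.-integrable (ball x e) (EFin \o u).
    exact: (integrableS (measurable_itvR `]0, T[) mb bD ui).
  have cb : mu.-integrable (ball x e) (EFin \o cst (u x)).
    rewrite ball_itv; apply: (integrable_itv_bounded (c := `|u x|)) => //.
  apply: (eq_integrable mb _ _ _ (integrableB mb ub cb)) => z /set_mem zb.
  by rewrite /= fx /f patchE mem_set//; exact: bD.
pose I := \int[mu]_(z in ball x e) `|f z - f x|.
have II : (\int[mu]_(z in ball x e) `|(f z - f x)%:E|)%E = I%:E.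
  rewrite /I /Rintegral fineK//; apply: integrable_fin_num => //.
  exact: integrable_abse fi.
have dE : davg f x e = ((e *+ 2)^-1 * I)%:E.
  rewrite /davg /iavg lebesgue_measure_ball ?ltW// II inver.
  by rewrite gt_eqF ?mulrn_wgt0.
rewrite dE/= [leRHS]ger0_norm; last first. 
  rewrite mulr_ge0// mulr_ge0//; last exact: Rintegral_ge0.
  by rewrite invr_ge0 mulrn_wge0// ltW.
rewrite (_ : 4 * _ = 2 / e * I); last by field; rewrite gt_eqF.
have fia : mu.-integrable (ball x e) (EFin \o (fun z => `|f z - f x|)).
  exact: (eq_integrable mb _ _ _ (integrable_abse fi)).
rewrite /I -RintegralZl//.
have gE z : z \in `]0, T[ -> `|g z| = ((fun z => `|g z|) \_ (ball x e)) z.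
  move=> _; rewrite patchE; case: ifPn => //.
  rewrite notin_setE ball_itv/= in_itv/= => /negP.
  rewrite negb_and -!leNgt => zb; rewrite /g tent_eq0 ?mulr0 ?subrr ?normr0//.
  by case/orP: zb => ?; [left|right]; lra.
rewrite (_ : Rintegral _ _ _ = \int[mu]_(z in `]0, T[)
    (((fun z => `|g z|) \_ (ball x e)) z)); last first.
  by apply: eq_Rintegral => z /set_mem; exact: gE.
rewrite -Rintegral_mkcondr (setIidr bD).
apply: le_Rintegral => //.
- apply: (integrableS (measurable_itvR `]0, T[) mb bD).
  exact: (eq_integrable (measurable_itvR _) _ _ _ (integrable_abse g_int)).
- exact: (eq_integrable mb _ _ _ (integrableZl mb (2 / e) fia)).
- move=> z zb; have zD := bD _ zb.
  rewrite fx {1}/f patchE mem_set// /g -mulrBl normrM mulrC distrC.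
  by rewrite ler_wpM2r// tent_shift_bounded.
Unshelve. all: by end_near. Qed.

End Variation_at_Lebesgue_points.

(** * Right-continuous representatives *)

Section Variation_of_representatives.
Context {R : realType}.
Implicit Types (T sigma x y z e : R) (u g : R -> R) (s : seq R).
Local Notation mu := (@lebesgue_measure R).

(** The bound on the mollified increments passes to the limit [e -> 0], every point of the list
    being a Lebesgue point. *)
Lemma vsum_le_BV T u sigma x s : path <=%R x s ->
  (forall y, y \in x :: s -> 0 < y < T /\ lebesgue_pt (u \_ `]0, T[) y) ->
  mu.-integrable `]0, T[ (EFin \o u) -> (BV_seminorm T u <= sigma%:E)%E ->
  vsum u x s <= sigma.
Proof.
move=> xs good ui us; rewrite -wsum_id.
have H : wsum u (tentconv T u e) x s @[e --> 0^'+] --> wsum u u x s.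
  apply: cvg_wsum => y ys; have [y0T yL] := good y ys.
  exact: tentconv_cvg.
have [/andP[l0 lT] _] := good _ (mem_last x s).
have [/andP[x0 xT] _] := good _ (mem_head x s).
rewrite -(cvg_lim _ H)//; apply: limr_le; first by apply/cvg_ex; eexists; exact: H.
near=> e; apply: wsum_tentconv_le => //.
rewrite -ltrBrDl; near: e; apply: nbhs_right_lt; rewrite subr_gt0//.
Unshelve. all: by end_near. Qed.

(* A right-continuous representative of a function in [D_sigma T sigma],
   extended by zero. *)
Definition rc_step T sigma g :=
  [/\ forall x, g x = 0 \/ g x = 1,
      forall x, x \notin `]0, T[ -> g x = 0,
      forall x, x \in `]0, T[ ->
        exists2 e, 0 < e & forall z, x <= z < x + e -> g z = g x
    & forall x s, path <=%R x s -> {in x :: s, forall y, y \in `]0, T[} ->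
        vsum g x s <= sigma].

Section Right_limits.
Variables (T sigma : R) (u : R -> R) (E : set R).
Hypothesis Edense : forall i j, 0 <= i -> i < j -> j <= T ->
  exists2 y, E y & i < y < j.
Hypothesis E01 : forall y, E y -> u y = 0 \/ u y = 1.
Hypothesis Evsum : forall x s, path <=%R x s ->
  {in x :: s, forall y, E y} -> vsum u x s <= sigma.

(** Otherwise [u] would change value along [E] arbitrarily often to the right of [x]; each change
    between 0 and 1 adds 1 to the variation, which would exceed [sigma]. *)
Lemma right_const x : 0 < x < T -> exists b, exists2 e, 0 < e &
  forall y, E y -> x < y < x + e -> u y = b.
Proof.
move=> /andP[x0 xT]; apply: contrapT => H.
have K b e : 0 < e -> exists y, [/\ E y, x < y < x + e & u y <> b].
  move=> e0; apply: contrapT => nex; apply: H; exists b, e => // y Ey yx.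
  by apply: contrapT => ub; apply: nex; exists y.
(* The list grows on its left: the new point lies between [x] and the current first point [y], and
   [u] takes the other value there. *)
have chain n : exists y s, [/\ x < y, path <=%R y s,
    {in y :: s, forall z, E z} & n%:R <= vsum u y s].
  elim: n => [|n [y [s [xy ys Es ns]]]].
    have [y [Ey /andP[xy _] _]] := K 0 1 ltr01.
    by exists y, [::]; split=> // z; rewrite inE => /eqP ->.
  have [z [Ez /andP[xz zy] uz]] := K (u y) (y - x) ltac:(by rewrite subr_gt0).
  exists z, (y :: s); split => //=.
  - by rewrite ys andbT; lra.
  - by move=> t; rewrite in_cons => /orP[/eqP ->//|]; exact: Es.
  - have Ey := Es y (mem_head _ _).
    have -> : `|u y - u z| = 1.
      move: uz; case: (E01 Ez) => ->; case: (E01 Ey) => -> //.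
        by rewrite subr0 normr1.
      by rewrite sub0r normrN normr1.
    by rewrite -natr1 addrC lerD.
have [y [s [_ ys Es]]] := chain (Num.truncn sigma).+1.
move=> /le_trans/(_ (Evsum ys Es)); rewrite leNgt => /negP; apply.
exact: truncnS_gt.
Qed.

(** The right limit of [u] along [E]. As this limit exists and is 0 or 1 inside []0, T[], testing
    for 1 determines it; outside the value is 0. *)
Definition rc_version x : R :=
  if `[< 0 < x < T /\ exists2 e, 0 < e &
         forall y, E y -> x < y < x + e -> u y = 1 >] then 1 else 0.

Lemma rc_version_right x : 0 < x < T -> exists2 e, 0 < e &
  forall y, E y -> x < y < x + e -> u y = rc_version x.
Proof.
move=> xT; have [b [e e0 eb]] := right_const xT.
exists e => // y Ey xye; rewrite /rc_version.
case: asboolP => [[_ [d d0 ud]]|nd].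
  have /andP[x0 xT'] := xT.
  have [z Ez /andP[xz zm]] : exists2 z, E z &
      x < z < Num.min (x + d) (Num.min (x + e) T).
    apply: Edense; first exact: ltW.
      by rewrite !lt_min xT' !ltrDl d0 e0.
    by rewrite !ge_min lexx !orbT.
  move: zm; rewrite !lt_min => /and3P[zd ze zT].
  by rewrite (eb y)// -(eb z)// ?xz// ud// xz.
case: (E01 Ey) => // u1; exfalso; apply: nd; split=> //; exists e => // z Ez xze.
by rewrite (eb z)// -(eb y).
Qed.

Lemma rc_version_step : rc_step T sigma rc_version.
Proof.
split.
- by move=> x; rewrite /rc_version; case: asboolP; [right|left].
- move=> x; rewrite in_itv/= => xT; rewrite /rc_version; case: asboolP => //.
  by move=> [h]; rewrite h in xT.
- move=> x; rewrite in_itv/= => xT; have /andP[x0 xT'] := xT.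
  have [d d0 ud] := rc_version_right xT.
  (* For [z] slightly to the right of [x], the points of [E] that determine the limit at [z] also
     lie in the interval on which [u] equals the limit at [x]. *)
  exists (Num.min d (T - x)); first by rewrite lt_min d0 subr_gt0.
  move=> z /andP[]; rewrite le_eqVlt => /predU1P[->//|xz].
  rewrite -ltrBlDl lt_min => /andP[zd zT].
  have zT' : 0 < z < T by lra.
  have [d' d'0 ud'] := rc_version_right zT'.
  have [y Ey /andP[zy]] : exists2 y, E y & z < y < Num.min (z + d') (Num.min (x + d) T).
    apply: Edense; first lra.
      by rewrite !lt_min ltrDl d'0; lra.
    by rewrite !ge_min lexx !orbT.
  rewrite !lt_min => /and3P[yd yd' yT].
  by rewrite -(ud' y)// ?zy// (ud y)//; lra.
(* Each point is moved to the right to a point of [E] where [u] has the value of [rc_version],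
   without passing the next distinct point. The variation along the moved points is then bounded by
   [Evsum]. *)
- have lift x s : path <=%R x s -> {in x :: s, forall y, y \in `]0, T[} ->
    forall d, 0 < d -> exists y l, [/\ x < y < x + d, path <=%R y l,
      {in y :: l, forall z, E z}, u y = rc_version x
    & vsum rc_version x s = vsum u y l].
    elim: s x => [|x' s IH] x /= xs sT d d0.
      have /= xT := sT x (mem_head _ _); rewrite in_itv/= in xT.
      have [e e0 ue] := rc_version_right xT.
      have /andP[x0 xT'] := xT.
      have [y Ey /andP[xy]] : exists2 y, E y & x < y < Num.min (x + d) (Num.min (x + e) T).
        apply: Edense; first exact: ltW.
          by rewrite !lt_min !ltrDl d0 e0.
        by rewrite !ge_min lexx !orbT.
      rewrite !lt_min => /and3P[yd ye yT].
      exists y, [::]; split=> //; first by rewrite xy.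
        by move=> z; rewrite inE => /eqP ->.
      by apply: ue; rewrite // xy.
    have /= xT := sT x (mem_head _ _); rewrite in_itv/= in xT.
    have sT' : {in x' :: s, forall y, y \in `]0, T[}.
      by move=> y ys; apply: sT; rewrite in_cons ys orbT.
    have /andP[xx' x's] := xs.
    have [y' [l' [xy' yl' El' uy' vE]]] := IH x' x's sT' d d0.
    (* A repeated point is lifted to the same point of [E] twice, which adds 0 to both sums. *)
    move: xx'; rewrite le_eqVlt => /predU1P[xx'|xx'].
      exists y', (y' :: l'); rewrite xx'; split=> //=; first by rewrite lexx.
        by move=> z; rewrite in_cons => /orP[/eqP ->|/El' //]; apply: El'; rewrite mem_head.
      by rewrite !subrr normr0 !add0r.
    have [e e0 ue] := rc_version_right xT.
    have /andP[x0 xT'] := xT.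
    have /= x'T := sT' x' (mem_head _ _); rewrite in_itv/= in x'T.
    have [y Ey /andP[xy]] : exists2 y, E y & x < y < Num.min (x + d) (Num.min (x + e) x').
      apply: Edense; first exact: ltW.
        by rewrite !lt_min !ltrDl d0 e0.
      by rewrite !ge_min; move/andP: x'T => [_ /ltW ->]; rewrite !orbT.
    rewrite !lt_min => /and3P[yd ye yx'].
    have uyx : u y = rc_version x by apply: ue; rewrite // xy.
    exists y, (y' :: l'); split=> //=; first by rewrite xy.
    - by rewrite yl' andbT; lra.
    - by move=> z; rewrite in_cons => /orP[/eqP ->//|/El'].
    - by rewrite vE uy' uyx.
  move=> x s xs sT; have [y [l [_ yl El _ ->]]] := lift x s xs sT 1 ltr01.
  exact: Evsum.
Qed.

End Right_limits.

(** [E] consists of the Lebesgue points where [u] is 0 or 1; it has full measure in []0, T[], hence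
    is dense there. *)
Lemma rc_version_exists T sigma u : 0 < T -> D_sigma T sigma u ->
  exists2 g, rc_step T sigma g &
    {ae mu, forall x, x \in `]0, T[ -> g x = u x}.
Proof.
move=> T0 [[/Lfun1_itv[mu_ ui] _] u01 us].
have L : {ae mu, forall x, lebesgue_pt (u \_ `]0, T[) x}.
  by apply: lebesgue_differentiation; exact: integrable_locally_restrict.
pose E := [set x | [/\ 0 < x < T, u x = 0 \/ u x = 1 & lebesgue_pt (u \_ `]0, T[) x]].
have aeE : {ae mu, forall x, x \in `]0, T[ -> E x}.
  apply: ae_mono2 u01 L => x /= h1 h2 xT; split=> //. exact: h1.
have Edense i j : 0 <= i -> i < j -> j <= T -> exists2 y, E y & i < y < j.
  move=> i0 ij jT; have [y yij Ey] := ae_meets_itv ij aeE.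
  exists y; last by rewrite in_itv/= in yij.
  by apply: Ey; move: yij; rewrite !in_itv/=; lra.
have E01 y : E y -> u y = 0 \/ u y = 1 by case.
have Evsum x s : path <=%R x s -> {in x :: s, forall y, E y} -> vsum u x s <= sigma.
  by move=> xs sE; apply: (vsum_le_BV xs _ ui us) => y /sE[].
have step := rc_version_step Edense E01 Evsum.
exists (rc_version T u E) => //; apply: ae_mono (aeE) => x /= Ex xT.
have [x0T _ xL] := Ex xT.
have [d d0 ud] := rc_version_right Edense E01 Evsum x0T.
(* At a point of [E] the mollification has two limits: [u x], by the Lebesgue property, and
   [rc_version T u E x], because [u] equals that constant almost everywhere just to the right of
   [x]. *)
have lim1 := tentconv_cvg x0T ui xL.
have lim2 : tentconv T u e x @[e --> 0^'+] --> rc_version T u E x.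
  have /andP[x0 xT'] := x0T.
  apply: cvg_near_cst; near=> e.
  have e0 : 0 < e by [].
  have xeT : x + e < T.
    by rewrite -ltrBrDl; near: e; apply: nbhs_right_lt; rewrite subr_gt0.
  have ed : e <= d by near: e; exact: nbhs_right_le.
  rewrite /tentconv -[RHS]mulr1 -[X in _ * X](Rintegral_tent e0 x0 xeT).
  have t_int : mu.-integrable `]0, T[ (EFin \o (fun z => tent e (z - x))).
    apply: (integrable_itv_bounded (c := 2 / e)).
      apply: measurable_funTS; apply: continuous_measurable_fun.
      exact: continuous_tent_shift.
    by move=> z _; exact: tent_shift_bounded.
  rewrite -RintegralZl//; congr fine; apply: ae_eq_integral => //.
  - exact: measurable_int (integrable_tent x e0 ui).
  - apply/measurable_EFinP; apply: measurable_funM => //.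
    by apply/measurable_EFinP; exact: measurable_int t_int.
  - apply: ae_mono aeE => z /= Ez zT; congr (_%:E).
    have [zx|zx] := boolP (x < z < x + e).
      congr (_ * _); apply: ud; first exact: Ez.
      by lra.
    rewrite tent_eq0 ?mulr0//.
    by move: zx; rewrite negb_and -!leNgt => /orP[?|?]; [left|right]; lra.
exact: (cvg_unique _ lim2 lim1).
Unshelve. all: by end_near. Qed.

End Variation_of_representatives.

(** * Steps of bounded variation belong to D_sigma *)

Section Regularity_of_steps.
Context {R : realType}.
Implicit Types (T sigma x y z e : R) (g phi : R -> R).
Local Notation mu := (@lebesgue_measure R).

Lemma sum_by_parts (c p : nat -> R) m :
  \sum_(j < m.+1) c j * (p j.+1 - p j) =
  c m * p m.+1 - c 0%N * p 0%N - \sum_(j < m) p j.+1 * (c j.+1 - c j).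
Proof.
elim: m => [|m IH]; first by rewrite big_ord1 big_ord0; ring.
by rewrite big_ord_recr/= IH [in RHS]big_ord_recr/=; ring.
Qed.

Lemma vsum_map_iota g (a : nat -> R) m k :
  vsum g (a m) [seq a j | j <- iota m.+1 k] =
  \sum_(j < k) `|g (a (m + j).+1) - g (a (m + j)%N)|.
Proof.
elim: k m => [|k IH] m /=; first by rewrite big_ord0.
rewrite big_ord_recl/= addn0 IH; congr (_ + _); apply: eq_bigr => j _.
by rewrite /bump/= add1n addnS addSn.
Qed.

Lemma path_map_iota (a : nat -> R) m k : {homo a : i j / (i <= j)%N >-> i <= j} ->
  path <=%R (a m) [seq a j | j <- iota m.+1 k].
Proof. by move=> ah; elim: k m => //= k IH m; rewrite ah//= IH. Qed.

Definition node T k (j : nat) : R := T * j%:R / k.+1%:R.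

Lemma node_homo T k : 0 <= T -> {homo node T k : i j / (i <= j)%N >-> i <= j}.
Proof.
by move=> T0 i j ij; rewrite /node ler_pM2r ?invr_gt0 ?ltr0n// ler_wpM2l ?ler_nat.
Qed.

Lemma node_lt T k j : 0 < T -> node T k j < node T k j.+1.
Proof.
by move=> T0; rewrite /node ltr_pM2r ?invr_gt0 ?ltr0n// ltr_pM2l ?ltr_nat.
Qed.

Lemma node0 T k : node T k 0 = 0. Proof. by rewrite /node mulr0 mul0r. Qed.

Lemma node_last T k : node T k k.+1 = T.
Proof. by rewrite /node mulfK// pnatr_eq0. Qed.

Lemma node_itv T k j : 0 <= T -> (j <= k.+1)%N -> 0 <= node T k j <= T.
Proof.
move=> T0 jk; have := node_homo k T0 jk; have := node_homo k T0 (leq0n j).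
by rewrite node0 node_last => -> ->.
Qed.

Lemma nodeS T k j : node T k j.+1 = node T k j + T / k.+1%:R.
Proof. by rewrite /node -[j.+1%:R]natr1 mulrDr mulr1 mulrDl. Qed.

Lemma node_cell T k x : 0 < T -> 0 <= x < T ->
  exists2 j, (j < k.+1)%N & node T k j <= x < node T k j.+1.
Proof.
move=> T0 /andP[x0 xT]; have k0 : 0 < k.+1%:R :> R by rewrite ltr0n.
pose y := x * k.+1%:R / T.
have y0 : 0 <= y by rewrite !mulr_ge0// invr_ge0 ltW.
have /andP[h1 h2] := truncn_itv y0.
exists (Num.truncn y).
  rewrite -(ltr_nat R); apply: (le_lt_trans h1).
  by rewrite /y ltr_pdivrMr// mulrC ltr_pM2l.
have yE : y * T = x * k.+1%:R by rewrite divfK ?gt_eqF.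
rewrite /node ler_pdivrMr// ltr_pdivlMr// -yE ![T * _]mulrC.
by rewrite ler_pM2r// ltr_pM2r// h1.
Qed.

(** Each cell carries the value at its right end, so that right continuity of [g] yields pointwise
    convergence. *)
Definition grid T g k x : R :=
  \sum_(j < k.+1) g (node T k j.+1) * \1_(`[node T k j, node T k j.+1[%classic) x.

Lemma gridE T g k j x : 0 < T -> (j < k.+1)%N ->
  node T k j <= x < node T k j.+1 -> grid T g k x = g (node T k j.+1).
Proof.
move=> T0 jk xj; rewrite /grid (bigD1 (Ordinal jk))//= big1 => [|i].
  by rewrite addr0 indicE mem_set ?mulr1//= in_itv.
rewrite -val_eqE/= => ij; rewrite indicE memNset ?mulr0//= in_itv/=.
move/andP: xj => [xj1 xj2].
case: (ltngtP i j) ij => // ij _; apply/negP; rewrite negb_and -!leNgt -?ltNge.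
  by rewrite (le_trans (node_homo k (ltW T0) ij) xj1) orbT.
by rewrite (lt_le_trans xj2 (node_homo k (ltW T0) ij)).
Qed.

Lemma measurable_grid T g k : measurable_fun setT (grid T g k).
Proof.
apply: measurable_sum => j; apply: measurable_funM => //.
Qed.

(** The sequence is eventually constant: once the mesh is below [e], the right end of the cell of
    [x] lies in [[x, x + e[], where [g] equals [g x]. *)
Lemma grid_cvg T sigma g x : 0 < T -> rc_step T sigma g -> x \in `]0, T[ ->
  grid T g k x @[k --> \oo] --> g x.
Proof.
move=> T0 [_ _ gr _] xT; have [e e0 ge] := gr x xT.
have Te : 0 < T^-1 * e by rewrite mulr_gt0 ?invr_gt0.
apply: cvg_near_cst; near=> k.
have kT : T / k.+1%:R < e.
  rewrite -ltr_pdivlMl//.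
  near: k; exact: (near_infty_natSinv_lt (PosNum Te)).
have [|j jk xj] := @node_cell T k x T0; first by move: xT; rewrite in_itv/=; lra.
rewrite (gridE g T0 jk xj) ge//; move: xj; rewrite nodeS.
by move: (node T k j) (T / _) kT => n h; lra.
Unshelve. all: by end_near. Qed.

Lemma measurable_rc_step T sigma g : 0 < T -> rc_step T sigma g ->
  measurable_fun setT g.
Proof.
move=> T0 sg; have [_ g0 _ _] := sg.
have -> : g = g \_ `]0, T[.
  apply/funext => x; rewrite patchE; case: ifPn => // xT.
  by apply: g0; apply/negP => xT'; move/negP: xT; apply; rewrite inE.
apply/(measurable_restrictT _ (measurable_itvR _)).
apply: (measurable_fun_cvg (h := grid T g)).
  by move=> k; apply: measurable_funTS; exact: measurable_grid.
by move=> x xT; apply: grid_cvg sg _.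
Qed.

End Regularity_of_steps.

Section Step_variation.
Context {R : realType}.
Implicit Types (T sigma x y z e : R) (g phi : R -> R).
Local Notation mu := (@lebesgue_measure R).

Lemma integrable_derive1 phi (i j : R) : continuous (derive1 phi) ->
  mu.-integrable `[i, j[ (EFin \o derive1 phi).
Proof.
move=> cphi; apply: (@integrableS _ _ _ mu `[i, j]) => //.
  by move=> x /=; rewrite !in_itv/= => /andP[-> /ltW ->].
apply: continuous_compact_integrable; first exact: segment_compact.
exact: continuous_subspaceT.
Qed.

Lemma integral_derive1 phi (i j : R) : i < j ->
  (forall x, derivable phi x 1) -> continuous (derive1 phi) ->
  (\int[mu]_(x in `[i, j[) (derive1 phi x)%:E = (phi j - phi i)%:E)%E.
Proof.
move=> ij dphi cphi.
have mphi : measurable_fun `]i, j[ (fun x => (derive1 phi x)%:E).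
  apply/measurable_EFinP; apply: measurable_funTS.
  exact: continuous_measurable_fun.
rewrite integral_itv_bndoo// -(integral_itv_bndoo true false mphi).
rewrite (@continuous_FTC2 _ _ phi)//.
  exact: continuous_subspaceT.
have cr z : {for z, continuous phi}.
  exact/differentiable_continuous/derivable1_diffP.
split=> [z _||].
+ exact: dphi.
+ by apply: cvg_at_right_filter; exact: cr.
+ by apply: cvg_at_left_filter; exact: cr.
Qed.

Lemma integral_grid T g phi k : 0 < T ->
  (forall x, derivable phi x 1) -> continuous (derive1 phi) ->
  (\int[mu]_(x in `]0%R, T[) (grid T g k x * derive1 phi x)%:E =
  (\sum_(j < k.+1) g (node T k j.+1) * (phi (node T k j.+1) - phi (node T k j)))%:E)%E.
Proof.
move=> T0 dphi cphi.
have mphi : measurable_fun setT (derive1 phi) by exact: continuous_measurable_fun.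
rewrite -(integral_itv_bndoo true true); last first.
  apply/measurable_EFinP/measurable_funM; apply: measurable_funTS => //.
  exact: measurable_grid.
have iphi := integrable_derive1 0 T cphi.
pose A j := `[node T k j, node T k j.+1[%classic.
pose f (j : 'I_k.+1) x := ((g (node T k j.+1))%:E * (derive1 phi x * \1_(A j) x)%:E)%E.
have ii (j : 'I_k.+1) : mu.-integrable `[0, T[ (EFin \o (fun x => derive1 phi x * \1_(A j) x)).
  apply: (integrable_mul_bounded (c := 1)) => //.
    by apply: measurable_indic; exact: measurable_itvR.
  by move=> x; rewrite indicE; case: (_ \in _); rewrite ?normr1 ?normr0.
rewrite (_ : integral _ _ _ =
    \int[mu]_(x in `[0%R, T[) (\sum_(j < k.+1) f j x))%E; last first.
  apply: eq_integral => x _; rewrite /f /grid big_distrl/= -sumEFin.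
  by apply: eq_bigr => j _; rewrite -EFinM -mulrA; congr (_ * _)%:E; exact: mulrC.
rewrite integral_sum//; last by move=> j; exact: integrableZl (ii j).
rewrite -sumEFin; apply: eq_bigr => j _.
rewrite /f (integralZl (measurable_itvR _) (ii j)) EFinM; congr (_ * _)%E.
rewrite -integral_derive1//; last exact: node_lt.
have AD : A j `<=` `[0, T[.
  move=> x; rewrite /A/= !in_itv/= => /andP[x1 x2]; apply/andP; split.
    by apply: le_trans x1; have /andP[] := node_itv (ltW T0) (ltnW (ltn_ord j)).
  by apply: (lt_le_trans x2); have /andP[] := node_itv (ltW T0) (ltn_ord j).
rewrite -/(A j) -[in RHS](setIidr AD) integral_mkcondr; apply: eq_integral => x _.
by rewrite patchE /= indicE; case: ifP; rewrite ?mulr1 ?mulr0.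
Qed.

(** Summation by parts moves the differences onto [g]. That [phi] vanishes at both ends of the last
    cell removes the value [g T], so only nodes inside []0, T[] remain and the variation bound of
    [g] applies. *)
Lemma grid_sum_le T sigma g phi k : 0 < T -> rc_step T sigma g ->
  (forall x, `|phi x| <= 1) -> (0 < k)%N ->
  phi 0 = 0 -> phi (node T k k) = 0 -> phi (node T k k.+1) = 0 ->
  \sum_(j < k.+1) g (node T k j.+1) *
    (phi (node T k j.+1) - phi (node T k j)) <= sigma.
Proof.
move=> T0 [_ _ _ gv] phi1; case: k => // k _ phi0 phik phik1.
rewrite big_ord_recr/= phik phik1 subrr mulr0 addr0.
have /= -> := sum_by_parts (fun j => g (node T k.+1 j.+1))
  (fun j => phi (node T k.+1 j)) k.
rewrite phik node0 phi0 !mulr0 subrr sub0r.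
set K := k.+1 in phik phik1 *.
apply: (@le_trans _ _ (vsum g (node T K 1) [seq node T K j | j <- iota 2 k])).
  rewrite vsum_map_iota -sumrN; apply: ler_sum => j _.
  rewrite add1n; apply: le_trans (ler_norm _) _; rewrite normrN normrM.
  by rewrite ler_piMl.
apply: gv; first by apply: path_map_iota; exact/node_homo/ltW.
have nT j : (0 < j < K.+1)%N -> node T K j \in `]0, T[.
  case: j => // j jk; rewrite in_itv/=; apply/andP; split.
    apply: le_lt_trans (node_lt K j T0).
    by have /andP[] := node_itv (ltW T0) (ltnW (ltnW jk)).
  by apply: lt_le_trans (node_lt K j.+1 T0) _; have /andP[] := node_itv (ltW T0) jk.
move=> y; rewrite in_cons => /orP[/eqP ->|/mapP[j + ->]].
  exact: nT.
rewrite mem_iota => /andP[j2 jk]; apply: nT.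
by rewrite (ltn_trans _ j2).
Qed.

(** The bound for the grid approximations passes to [g] by dominated convergence, the dominating
    constant being the maximum of the derivative of [phi] in absolute value on [[0, T]]. *)
Lemma rc_step_BV_seminorm T sigma g : 0 < T -> rc_step T sigma g ->
  (BV_seminorm T g <= sigma%:E)%E.
Proof.
move=> T0 sg; have [g01 _ _ _] := sg.
apply: ge_ereal_sup => _ [phi [[dphi cphi [s [t [s0 tT st]]]] phi1] <-].
have mphi : measurable_fun setT (derive1 phi) by exact: continuous_measurable_fun.
have phi0 : phi 0 = 0 by apply: st; rewrite in_itv/= leNgt s0.
have phit x : t < x -> phi x = 0.
  by move=> tx; apply: st; rewrite in_itv/= negb_and -!ltNge tx orbT.
have [c _ phic] : exists2 c, c \in `[0, T] &
    forall x, x \in `[0, T] -> `|derive1 phi x| <= `|derive1 phi c|.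
  apply: EVT_max; first exact: ltW.
  apply: continuous_subspaceT => x; apply: continuous_comp; first exact: cphi.
  exact: norm_continuous.
have grid1 k x : x \in `]0, T[ -> `|grid T g k x| <= 1.
  rewrite in_itv/= => /andP[x0 xT].
  have [|j jk xj] := @node_cell _ T k x T0; first by rewrite ltW.
  by rewrite (gridE g T0 jk xj); case: (g01 (node T k j.+1)) => ->;
    rewrite ?normr0 ?normr1.
have lim : (\int[mu]_(x in `]0%R, T[) (grid T g k x * derive1 phi x)%:E @[k --> \oo]
    --> \int[mu]_(x in `]0%R, T[) (g x * derive1 phi x)%:E)%E.
  apply: (@dominated_cvg _ _ _ mu _ (measurable_itvR _) _ _ (cst (`|derive1 phi c|)%:E)) => //.
  - move=> k; apply/measurable_EFinP/measurable_funTS/measurable_funM => //.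
    exact: measurable_grid.
  - move=> x xT; apply/cvg_EFin; first exact: nearW.
    by apply: cvgMl; apply: grid_cvg sg _.
  - apply: (integrable_itv_bounded (c := `|derive1 phi c|) (f := cst _)) => // x _.
    by rewrite normr_id.
  - move=> k x xT /=; rewrite lee_fin normrM -[leRHS]mul1r ler_pM//.
      exact: grid1.
    by apply: phic; move: xT; rewrite /= !in_itv/= => /andP[/ltW -> /ltW ->].
rewrite -(cvg_lim _ lim)//; apply: lime_le; first by apply/cvg_ex; eexists; exact: lim.
(* The support of [phi] ends at [t < T]; when the mesh is below [T - t], the whole last cell lies
   beyond [t]. *)
have tT' : 0 < T^-1 * (T - t) by rewrite mulr_gt0 ?invr_gt0 ?subr_gt0.
near=> k.
have kT : T / k.+1%:R < T - t.
  rewrite -ltr_pdivlMl//.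
  near: k; exact: (near_infty_natSinv_lt (PosNum tT')).
have phik : phi (node T k k) = 0.
  apply: phit; move: (nodeS T k k); rewrite node_last.
  by move: (node T k k) (T / _) kT => n h; lra.
rewrite integral_grid// lee_fin; apply: (grid_sum_le T0 sg phi1) => //.
- by near: k; exists 1%N.
- by apply: phit; rewrite node_last.
Unshelve. all: by end_near. Qed.

Lemma rc_step_D_sigma T sigma g : 0 < T -> rc_step T sigma g -> D_sigma T sigma g.
Proof.
move=> T0 sg; have [g01 _ _ _] := sg.
have mg := measurable_rc_step T0 sg.
have gs := rc_step_BV_seminorm T0 sg.
split=> //; last by apply: ae_mono (aeW mu (fun x => g01 x)).
split; last by rewrite (le_lt_trans gs)// ltry.
apply/Lfun1_itv; split=> //; apply: (integrable_itv_bounded (c := 1)) => //.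
  exact: measurable_funTS.
by move=> x _; case: (g01 x) => ->; rewrite ?normr0 ?normr1.
Qed.

End Step_variation.

(** * Collapsing the intervals *)

Section Splice.
Context {R : realType}.
Implicit Types (T sigma x y z e : R) (g u v : R -> R).
Local Notation mu := (@lebesgue_measure R).

(** If [v t] and [g t] differed, a point [z] just to the right of [t] with [v z = g z = g t] would
    contradict the right continuity of [v]. *)
Lemma rc_representative_step T sigma u v g : rc_step T sigma g ->
  {ae mu, forall x, x \in `]0, T[ -> g x = u x} -> rc_representative T u v ->
  forall x, x \in `]0, T[ -> v x = g x.
Proof.
move=> [_ _ gr _] gu [vu vr] t tT; apply: contrapT => /eqP vg.
have [e e0 ge] := gr t tT.
have d0 : 0 < `|v t - g t| by rewrite normr_gt0 subr_eq0.
have /cvgrPdist_lt/(_ _ d0)[r /= r0 rv] := vr t tT.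
have tT2 : 0 < t < T by move: tT; rewrite in_itv.
pose m := Num.min (t + r) (Num.min (t + e) T).
have tm : t < m by rewrite !lt_min !ltrDl r0 e0; case/andP: tT2.
have [z] := ae_meets_itv tm (ae_mono2 (fun x p q => conj p q) gu vu).
rewrite in_itv/= !lt_min => /andP[tz /and3P[zr ze zT]] [h1 h2].
have zT' : z \in `]0, T[ by rewrite in_itv/= zT; lra.
have zr' : `|t - z| < r by rewrite ltr_distlC; lra.
have /= := rv z zr' tz.
by rewrite (h2 zT') -(h1 zT') ge ?ltxx//; lra.
Qed.

Section Intervals.
Variables (T : R) (M : nat) (a b s : 'I_M -> R).
Hypothesis hab : forall i, [/\ 0 <= a i, a i < b i & b i <= T].
Hypothesis Idisj : forall i k : 'I_M, i != k ->
  `]a i, b i[ `&` `]a k, b k[ = set0.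

Lemma itv_disjoint_order i k : i != k -> b i <= a k \/ b k <= a i.
Proof.
move=> ik; have := Idisj ik; have [_ abi _] := hab i; have [_ abk _] := hab k.
have [|bi] := leP (b i) (a k); first by left.
have [|bk] := leP (b k) (a i); first by right.
(* Otherwise the midpoint of the overlap, between the larger left end and the smaller right end,
   lies in both intervals. *)
move=> /seteqP[/(_ ((Num.max (a i) (a k) + Num.min (b i) (b k)) / 2)) + _].
case; split; rewrite /= in_itv/= maxEle minEle; case: ifP; case: ifP; lra.
Qed.

(** Half-open blocks make precomposition preserve right continuity. With [d > 0] the end [a i],
    which may be some [tau j], stays outside its block together with a right neighbourhood; [d = 0]
    gives the limit function, constant on every interval. *)
Definition squeeze d x : R :=
  if [pick i | a i + d <= x < b i] is Some i then s i else x.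

Lemma squeezeP d x :
  (exists2 i, a i + d <= x < b i & squeeze d x = s i) \/
  ((forall i, ~~ (a i + d <= x < b i)) /\ squeeze d x = x).
Proof.
rewrite /squeeze; case: pickP => [i xi|none]; first by left; exists i.
by right; split=> // i; rewrite none.
Qed.

Lemma squeeze_in d i x : 0 <= d -> a i + d <= x < b i -> squeeze d x = s i.
Proof.
move=> d0 xi; have [[k xk ->]|[/(_ i)]] := squeezeP d x; last by rewrite xi.
have [->//|ik] := eqVneq k i.
by case: (itv_disjoint_order ik) => ?; lra.
Qed.

Section Squeeze.
Variable d : R.
Hypothesis d0 : 0 <= d.
Hypothesis sd : forall i, a i + d <= s i < b i.

(** The blocks are disjoint intervals and each is collapsed to one of its own points. *)
Lemma squeeze_homo : {homo squeeze d : x y / x <= y}.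
Proof.
move=> x y xy; have ? := d0.
have [[i xi ->]|[xn ->]] := squeezeP d x;
  have [[k yk ->]|[yn ->]] := squeezeP d y => //.
- have [->//|ik] := eqVneq i k; have /andP[? ?] := sd i; have /andP[? ?] := sd k.
  have /andP[? ?] := xi; have /andP[? ?] := yk.
  by case: (itv_disjoint_order ik) => ?; lra.
- have /andP[? ?] := sd i; have /andP[? ?] := xi.
  by have := yn i; rewrite negb_and -leNgt -ltNge => /orP[] ?; lra.
- have /andP[? ?] := sd k; have /andP[? ?] := yk.
  by have := xn k; rewrite negb_and -leNgt -ltNge => /orP[] ?; lra.
Qed.

Lemma squeeze_itv x : 0 < x < T -> (forall i, 0 < s i) -> 0 < squeeze d x < T.
Proof.
move=> xT s0; have [[i xi ->]|[_ ->]//] := squeezeP d x.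
by have [? ? ?] := hab i; have /andP[? ?] := sd i; have ? := s0 i; lra.
Qed.

(** Being before the closed left end of a block, or at or after its open right end, persists
    slightly to the right, and there are finitely many blocks. *)
Lemma squeeze_right_id x : (forall i, ~~ (a i + d <= x < b i)) ->
  \forall z \near x^'+, squeeze d z = z.
Proof.
move=> xn.
have H : \forall z \near x^'+, forall i, ~~ (a i + d <= z < b i).
  apply: filter_forall => i.
  have := xn i; rewrite negb_and -leNgt -ltNge => /orP[xa|bx].
    near=> z; rewrite negb_and -ltNge; apply/orP; left.
    by near: z; apply: nbhs_right_lt.
  near=> z; rewrite negb_and -leNgt; apply/orP; right.
  by rewrite (le_trans bx)//; near: z; exact: nbhs_right_ge.
near=> z; have [[i zi _]|[_ ->]//] := squeezeP d z.
by have /(_ i) : forall i, ~~ (a i + d <= z < b i); [near: z|rewrite zi].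
Unshelve. all: by end_near. Qed.

Definition splice g x : R := if 0 < x < T then g (squeeze d x) else 0.

Lemma splice_step sigma g : (forall i, 0 < s i) ->
  rc_step T sigma g -> rc_step T sigma (splice g).
Proof.
move=> s0 [g01 g0 gr gv]; split.
- by move=> x; rewrite /splice; case: ifP => _; [exact: g01|left].
- by move=> x; rewrite in_itv/= /splice => /negbTE ->.
- move=> x; rewrite in_itv/= => xT; have /andP[x0 xT'] := xT.
  have [[i xi sx]|[xn sx]] := squeezeP d x.
    have [a0 ab bT] := hab i; have /andP[xi1 xi2] := xi.
    exists (b i - x); rewrite ?subr_gt0// => z /andP[xz].
    rewrite addrC subrK => zb; rewrite /splice xT.
    have -> : 0 < z < T by lra.
    by rewrite sx (@squeeze_in _ i)//; lra.
  have [e e0 ge] := gr x ltac:(by rewrite in_itv).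
  have [r /= r0 rs] := squeeze_right_id xn.
  exists (Num.min r (Num.min e (T - x))).
    by rewrite !lt_min r0 e0 subr_gt0.
  move=> z; rewrite le_eqVlt => /andP[/predU1P[->//|xz]].
  rewrite -ltrBlDl !lt_min => /and3P[zr ze zT].
  rewrite /splice xT; have -> : 0 < z < T by lra.
  rewrite sx rs//; last by rewrite /ball_/= ltr_distlC; lra.
  by apply: ge; lra.
- move=> x l xl lT.
  have -> : vsum (splice g) x l = vsum (g \o squeeze d) x l.
    have E y : y \in x :: l -> splice g y = (g \o squeeze d) y.
      by move=> /lT; rewrite in_itv/= /splice => ->.
    apply: eq_vsum; first by apply: E; exact: mem_head.
    by move=> y yl; apply: E; rewrite in_cons yl orbT.
  (* The sum equals that of [g] along the image points, which are again ordered because [squeeze] is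
     monotone. *)
  rewrite -vsum_map; apply: gv; first exact: homo_path squeeze_homo xl.
  rewrite -map_cons => _ /mapP[y yl ->]; have := lT y yl.
  by rewrite !in_itv/= => yT; exact: squeeze_itv.
Qed.

End Squeeze.
End Intervals.
End Splice.

(** * Spliced steps in the closure of [D_SP] *)

Section Closure.
Context {R : realType}.
Implicit Types (x y z e d : R) (g u v : R -> R).
Local Notation mu := (@lebesgue_measure R).

Lemma rc_representative_refl (T sigma : R) g : rc_step T sigma g ->
  rc_representative T g g.
Proof.
move=> [_ _ gr _]; split; first exact: aeW.
move=> t tT; have [e e0 ge] := gr t tT; apply: cvg_near_cst.
near=> z; apply: ge; apply/andP; split; first by near: z; exact: nbhs_right_ge.
by near: z; apply: nbhs_right_lt; rewrite ltrDl.
Unshelve. all: by end_near. Qed.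

Section Fixings.
Variables (T sigma p : R) (N : nat) (tau : 'I_N -> R) (c : 'I_N -> bool).
Variables (M : nat) (a b : 'I_M -> R).
Hypothesis T0 : 0 < T.
Hypothesis p1 : 1 <= p.
Hypothesis htau : forall j, 0 <= tau j < T.
Hypothesis hab : forall i, [/\ 0 <= a i, a i < b i & b i <= T].
Hypothesis Idisj : forall i k : 'I_M, i != k ->
  `]a i, b i[ `&` `]a k, b k[ = set0.
Hypothesis tauI : forall (i : 'I_M) (j : 'I_N), tau j \notin `]a i, b i[.

Section Splices.
Variables (u g : R -> R) (s : 'I_M -> R).
Hypothesis uD : D_SP T sigma tau c u.
Hypothesis gstep : rc_step T sigma g.
Hypothesis gu : {ae mu, forall x, x \in `]0, T[ -> g x = u x}.
Hypothesis hs : forall i, a i < s i < b i.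

Let s_gt0 i : 0 < s i.
Proof. by have [a0 _ _] := hab i; have /andP[] := hs i; lra. Qed.

(** A block [[a i + d, b i[] is contained in []a i, b i[], hence contains no [tau j], and [squeeze]
    fixes every [tau j]. *)
Lemma splice_D_SP d : 0 < d -> (forall i, a i + d <= s i) ->
  D_SP T sigma tau c (splice T a b s d g).
Proof.
move=> d0 sd.
have sd' i : a i + d <= s i < b i by rewrite sd; have /andP[] := hs i.
have vstep := splice_step hab Idisj (ltW d0) sd' s_gt0 gstep.
split; first exact: rc_step_D_sigma.
move=> j; have [_ /(_ j)[r ur rj]] := uD.
have rg := rc_representative_step gstep gu ur.
exists (splice T a b s d g); first exact: rc_representative_refl vstep.
have /andP[t0 tT] := htau j.
have tn i : ~~ (a i + d <= tau j < b i).
  by apply: contra (tauI i j) => /andP[? ?]; rewrite in_itv/=; lra.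
case: eqP rj => [tj0|/eqP tj0] rj; last first.
  have tT' : 0 < tau j < T by rewrite tT lt_neqAle eq_sym tj0 t0.
  rewrite /splice tT' -rj rg ?in_itv//.
  by have [[i ti _]|[_ ->//]] := squeezeP a b s d (tau j); have := tn i; rewrite ti.
(* At [tau j = 0] the prescribed value is a right limit; it is kept because [squeeze] is the
   identity on a right neighbourhood of 0. *)
rewrite tj0 in tn; apply: cvg_trans rj; apply: near_eq_cvg.
have sid := squeeze_right_id s tn.
near=> x; have x0 : 0 < x by near: x; exact: nbhs_right_gt.
have xT' : x < T by near: x; exact: nbhs_right_lt.
have xT : 0 < x < T by rewrite x0.
rewrite /splice xT rg ?in_itv//; congr g; near: x.
by apply: filterS sid => x ->.
Unshelve. all: by end_near. Qed.

(** The splices for [0] and [d] are 0/1 functions that differ only on the union of the [[a i, a i +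
    d[], so the [p]-th power of their distance is at most [M * d]. *)
Lemma splice_Lp_closure : Lp_closure T p (D_SP T sigma tau c) (splice T a b s 0 g).
Proof.
have p0 : 0 < p by apply: lt_le_trans p1.
have s0 i : a i + 0 <= s i < b i by rewrite addr0; have /andP[/ltW -> ->] := hs i.
have wstep := splice_step hab Idisj (lexx 0) s0 s_gt0 gstep.
have mw := measurable_rc_step T0 wstep.
have bounded (v : R -> R) : rc_step T sigma v -> forall x, `|v x| <= 1.
  by move=> [v01 _ _ _] x; case: (v01 x) => ->; rewrite ?normr0 ?normr1.
split; first by apply: (@Lfun_bounded _ T p _ 1) => //; exact: bounded wstep.
move=> e e0.
have [d [d0 sd de]] : exists d, [/\ 0 < d, forall i, a i + d <= s i & M%:R * d < e `^ p].
  have H1 : \forall d \near (0 : R)^'+, forall i, a i + d <= s i.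
    apply: filter_forall => i; near=> d; rewrite -lerBrDl.
    by near: d; apply: nbhs_right_le; have /andP[] := hs i; rewrite subr_gt0.
  have H2 : \forall d \near (0 : R)^'+, M%:R * d < e `^ p.
    near=> d; have d0 : 0 < d by [].
    (* [M] may be 0, so [M.+1] is used as divisor. *)
    apply: (@le_lt_trans _ _ (M.+1%:R * d)); first by rewrite ler_pM2r// ler_nat.
    rewrite -ltr_pdivlMl//; near: d; apply: nbhs_right_lt.
    by rewrite mulr_gt0 ?invr_gt0// powR_gt0.
  have [d [d0 [h1 h2]]] := filter_ex (filterI (nbhs_right_gt 0) (filterI H1 H2)).
  by exists d.
have sd' i : a i + d <= s i < b i by rewrite sd; have /andP[] := hs i.
have vstep := splice_step hab Idisj (ltW d0) sd' s_gt0 gstep.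
have mv := measurable_rc_step T0 vstep.
exists (splice T a b s d g); first exact: splice_D_SP.
have mD : measurable_fun setT (splice T a b s 0 g \- splice T a b s d g).
  exact: measurable_funB.
rewrite LnormE_itv//.
set I := (\int[mu]_(x in _) _)%E.
have IM : (I <= (M%:R * d)%:E)%E.
  apply: (@le_trans _ _ (\int[mu]_(x in `]0%R, T[)
     (\sum_(i < M) (\1_(`[a i, a i + d[%classic) x)%:E))%E).
    apply: ge0_le_integral => //.
    - apply/measurable_EFinP/measurable_funTS.
      apply: (@measurableT_comp _ _ _ _ _ _ (@powR R ^~ p)) => //.
      exact: measurableT_comp.
    - apply: emeasurable_sum => i; apply/measurable_EFinP.
      by apply: measurable_indic; exact: measurable_itvR.
    - move=> x xT; rewrite sumEFin lee_fin /=.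
      have xT' : 0 < x < T by move: xT; rewrite /= in_itv.
      have s_ge0 (P : pred 'I_M) : 0 <= \sum_(i < M | P i) \1_(`[a i, a i + d[%classic) x :> R.
        by apply: sumr_ge0 => i _; rewrite indicE ler0n.
      have [E|nE] := eqVneq (squeeze a b s 0 x) (squeeze a b s d x).
        by rewrite /splice xT' E subrr normr0 powR0 ?gt_eqF.
      (* The two maps can differ at [x] only if [x] is in a block for [0] but in none for [d]. *)
      have [i xi] : exists i, a i <= x < a i + d.
        have [[i xi si]|[xn sx]] := squeezeP a b s 0 x.
          exists i; move: xi; rewrite addr0 => /andP[xa xb]; rewrite xa/= ltNge.
          apply: contra nE => adx.
          by rewrite si (squeeze_in s hab Idisj (ltW d0) (i := i)) ?adx.
        have [[i /andP[xi1 xi2] _]|[_ sx']] := squeezeP a b s d x.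
          by have := xn i; rewrite addr0 xi2 andbT; lra.
        by rewrite sx sx' eqxx in nE.
      apply: (@le_trans _ _ 1).
        have -> : 1 = 1 `^ p :> R by rewrite powR1.
        apply: ge0_ler_powR; rewrite ?nnegrE ?(ltW p0)//.
        have [w01 _ _ _] := wstep; have [v01 _ _ _] := vstep.
        by case: (w01 x) => ->; case: (v01 x) => ->;
          rewrite ?subrr ?subr0 ?sub0r ?normrN ?normr0 ?normr1.
      by rewrite (bigD1 i)//= indicE mem_set/= ?in_itv//= lerDl.
  rewrite ge0_integral_sum//; last first.
    move=> i; apply/measurable_EFinP.
    by apply: measurable_indic; exact: measurable_itvR.
  rewrite (_ : M%:R * d = \sum_(i < M) d); last first.
    by rewrite sumr_const card_ord mulr_natl.
  rewrite -sumEFin; apply: lee_sum => i _.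
  rewrite (integral_indic mu (measurable_itvR _) (measurable_itvR _)).
  apply: (@le_trans _ _ (mu `[a i, a i + d[%classic)).
    by apply: le_measure; rewrite ?inE//; apply: measurableI; exact: measurable_itvR.
  rewrite lebesgue_measure_itv/= lte_fin ltrDl d0 -EFinB lee_fin.
  by rewrite addrAC subrr add0r.
have I0 : (0 <= I)%E by apply: integral_ge0 => x _; rewrite lee_fin powR_ge0.
have Md0 : 0 <= M%:R * d by rewrite mulr_ge0// ltW.
apply: (@le_lt_trans _ _ ((M%:R * d)%:E `^ p^-1)%E).
  apply: gt0_ler_poweR => //; rewrite ?invr_ge0 ?(ltW p0)// in_itv/= ?leey ?andbT//.
rewrite poweR_EFin lte_fin.
have -> : e = (e `^ p) `^ p^-1 by rewrite -powRrM divff ?gt_eqF// powRr1// ltW.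
by apply: gt0_ltr_powR; rewrite ?invr_gt0// nnegrE// powR_ge0.
Unshelve. all: by end_near. Qed.

Lemma local_average_splice :
  local_average a b (splice T a b s 0 g) = \row_i g (s i).
Proof.
apply/rowP => i; rewrite !mxE; have [a0 ab bT] := hab i.
rewrite (_ : Rintegral _ _ _ = \int[mu]_(x in `]a i, b i[) (cst (g (s i)) x)).
  rewrite Rintegral_cst//= lebesgue_measure_itv/= lte_fin ab -EFinB/=.
  by rewrite mulrC mulfK// subr_eq0 gt_eqF.
apply: eq_Rintegral => x /set_mem /=; rewrite in_itv/= => /andP[xa xb].
rewrite /splice; have -> : 0 < x < T by lra.
by rewrite (squeeze_in s hab Idisj (lexx 0) (i := i))// addr0 (ltW xa).
Qed.

End Splices.
End Fixings.
End Closure.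

(** * Faces of the cube *)

Section Box.
Context {R : realType} {m : nat}.
Implicit Types (y : 'rV[R]_m) (C : set 'rV[R]_m).

Lemma convex_setP C y z (l : R) : convex_set C -> 0 <= l <= 1 ->
  C y -> C z -> C (l *: y + (1 - l) *: z).
Proof.
move=> Cc l01 Cy Cz.
have [l0 l1] := andP l01.
have := Cc y z (Itv01 l0 l1) (mem_set Cy) (mem_set Cz).
by rewrite inE.
Qed.

(* [y] lies in the relative interior of a face of the unit cube, whose vertices
   are the vectors [v] of the hypothesis. *)
Lemma convex_set_cube C y : convex_set C ->
  (forall i, 0 <= y ord0 i <= 1) ->
  (forall v : 'rV[R]_m, (forall i, v ord0 i = 0 /\ y ord0 i < 1 \/
                     v ord0 i = 1 /\ 0 < y ord0 i) -> C v) ->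
  C y.
Proof.
(* Induction on the number of coordinates of [y] strictly between 0 and 1; with none left, [y] is
   itself one of the vertices. *)
move=> Cc; move: {2}(#|_|) (leqnn #|[pred i | 0 < y ord0 i < 1]|) => n.
elim: n y => [|n IH] y yn y01 H.
  apply: H => i; have /andP[y0 y1] := y01 i.
  have : ~~ (0 < y ord0 i < 1).
    by move: yn; rewrite leqn0 => /eqP/card0_eq/(_ i); rewrite inE => ->.
  rewrite negb_and -!leNgt => /orP[h|h].
    by left; have -> : y ord0 i = 0 by apply: le_anti; rewrite h.
  by right; have -> : y ord0 i = 1 by apply: le_anti; rewrite h y1.
have [i yi|none] := pickP (fun i => 0 < y ord0 i < 1); last first.
  by apply: IH => //; rewrite eq_card0.
(* Replacing coordinate [i] by 0 and by 1 gives the ends of a segment through [y]; both have fewer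
   fractional coordinates, and the vertices required for them are among those for [y]. *)
pose z b : 'rV[R]_m := \row_k (if k == i then b else y ord0 k).
have -> : y = y ord0 i *: z 1 + (1 - y ord0 i) *: z 0.
  by apply/rowP => k; rewrite !mxE; case: eqP => [->|_]; rewrite ?ord1; ring.
have Cz b : b = 0 \/ b = 1 -> C (z b).
  move=> b01; apply: IH => [|k|v vz].
  - rewrite -ltnS; apply: leq_trans yn; apply: proper_card.
    apply/properP; split.
      apply/fintype.subsetP => k; rewrite !inE mxE; case: eqP => // _.
      by case: b01 => ->; rewrite ltxx ?andbF.
    exists i; rewrite !inE ?yi// mxE eqxx.
    by case: b01 => ->; rewrite ltxx ?andbF.
  - by rewrite mxE; case: eqP => // _; case: b01 => ->; rewrite ?lexx ?ler01.
  - apply: H => k; have := vz k; rewrite mxE; case: eqP => // -> _.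
    move/andP: yi => [yi0 yi1].
    have [] := vz i; rewrite mxE eqxx => -[-> _]; by [left|right].
by apply: convex_setP => //; apply: Cz; [right|left].
Qed.

End Box.

(** * Local averages *)

Section Averages.
Context {R : realType}.
Implicit Types (x y z e d : R) (g u v : R -> R).
Local Notation mu := (@lebesgue_measure R).

Section Average_of_step.
Variables (T sigma : R) (M : nat) (a b : 'I_M -> R) (g : R -> R).
Hypothesis T0 : 0 < T.
Hypothesis hab : forall i, [/\ 0 <= a i, a i < b i & b i <= T].
Hypothesis gstep : rc_step T sigma g.

Lemma average_ae_eq u : measurable_fun setT u ->
  {ae mu, forall x, x \in `]0, T[ -> g x = u x} ->
  local_average a b u = local_average a b g.
Proof.
move=> mu_ gu; have mg := measurable_rc_step T0 gstep.
apply/rowP => i; rewrite !mxE; congr (_ * fine _); have [a0 ab bT] := hab i.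
apply: ae_eq_integral => //.
- by apply/measurable_EFinP/measurable_funTS.
- by apply/measurable_EFinP/measurable_funTS.
- apply: ae_mono gu => x gx xi; congr EFin; apply/esym/gx.
  by move: xi; rewrite /= !in_itv/=; lra.
Qed.

Lemma average_cst i (r : R) : (forall x, x \in `]a i, b i[ -> g x = r) ->
  local_average a b g ord0 i = r.
Proof.
move=> gr; rewrite mxE; have [a0 ab bT] := hab i.
rewrite (_ : Rintegral _ _ _ = \int[mu]_(x in `]a i, b i[) (cst r x)).
  rewrite Rintegral_cst//= lebesgue_measure_itv/= lte_fin ab -EFinB/=.
  by rewrite mulrC mulfK// subr_eq0 gt_eqF.
by apply: eq_Rintegral => x /set_mem /gr.
Qed.

Lemma average_itv i : 0 <= local_average a b g ord0 i <= 1.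
Proof.
have [a0 ab bT] := hab i; have [g01 _ _ _] := gstep.
have ba : 0 < b i - a i by rewrite subr_gt0.
have mg := measurable_rc_step T0 gstep.
have itv (h : R -> R) : measurable_fun setT h -> (forall x, h x = 0 \/ h x = 1) ->
    mu.-integrable `]a i, b i[ (EFin \o h).
  move=> mh h01; apply: (integrable_itv_bounded (c := 1)).
    exact: measurable_funTS.
  by move=> x _; case: (h01 x) => ->; rewrite ?normr0 ?normr1.
rewrite mxE mulr_ge0 ?invr_ge0 ?(ltW ba)//=; last first.
  by apply: Rintegral_ge0 => x _; case: (g01 x) => ->.
rewrite mulrC ler_pdivrMr// mul1r.
have -> : b i - a i = \int[mu]_(x in `]a i, b i[) (cst 1 x).
  by rewrite Rintegral_cst//= lebesgue_measure_itv/= lte_fin ab -EFinB/= mul1r.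
apply: le_Rintegral => //.
- exact: itv.
- by apply: itv => // x; right.
- by move=> x _; case: (g01 x) => ->.
Qed.

(** If [r] were not attained, [g] would be constant with the other value on the interval, and its
    average would be that value. *)
Lemma average_attains i (r : R) :
  r = 0 /\ local_average a b g ord0 i < 1 \/
  r = 1 /\ 0 < local_average a b g ord0 i ->
  exists x, a i < x < b i /\ g x = r.
Proof.
have [g01 _ _ _] := gstep.
case=> -[-> h]; apply: contrapT => nex.
- suff E : local_average a b g ord0 i = 1 by rewrite E ltxx in h.
  apply: average_cst => x xi; case: (g01 x) => // gx; exfalso; apply: nex.
  by exists x; move: xi; rewrite in_itv.
- suff E : local_average a b g ord0 i = 0 by rewrite E ltxx in h.
  apply: average_cst => x xi; case: (g01 x) => // gx; exfalso; apply: nex.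
  by exists x; move: xi; rewrite in_itv.
Qed.

End Average_of_step.

(** The [L^p] bound controls the [L^1] distance on []0, T[], hence the integral of the difference
    over a subinterval. *)
Lemma average_Lnorm (T p eta : R) (M : nat) (a b : 'I_M -> R) i u v :
  0 < T -> 1 <= p -> 0 < eta -> 0 <= a i -> a i < b i -> b i <= T ->
  u \in Lfun (lebesgue_on T) 1%E -> v \in Lfun (lebesgue_on T) 1%E ->
  ('N[lebesgue_on T]_p%:E[EFin \o (u \- v)%R] < eta%:E)%E ->
  `|local_average a b u ord0 i - local_average a b v ord0 i| <=
    eta * (T + 1) / (b i - a i).
Proof.
move=> T0 p1 eta0 a0 ab bT /Lfun1_itv[mu_ ui] /Lfun1_itv[mv vi] uv.
have sub : `]a i, b i[ `<=` `]0, T[.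
  by move=> x; rewrite /= !in_itv/=; lra.
have mi : measurable (`]a i, b i[ : set (measurableTypeR R)).
  exact: measurable_itvR.
have mD : measurable (`]0, T[ : set (measurableTypeR R)).
  exact: measurable_itvR.
have ba : 0 < b i - a i by rewrite subr_gt0.
rewrite !mxE -mulrBr normrM ger0_norm ?invr_ge0 ?(ltW ba)// mulrC.
rewrite ler_pM2r ?invr_gt0//.
have iu := integrableS mD mi sub ui.
have iv := integrableS mD mi sub vi.
rewrite -RintegralB//.
have iuv : mu.-integrable `]a i, b i[ (EFin \o (u \- v)).
  exact: (eq_integrable mi _ _ _ (integrableB mi iu iv)).
apply: (le_trans (le_normr_Rintegral mi iuv)).
have muv : measurable_fun setT (u \- v) by exact: measurable_funB.
rewrite -lee_fin; apply: le_trans (L1_le_Lnorm (ltW T0) p1 eta0 muv uv).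
rewrite /Rintegral fineK.
  apply: ge0_subset_integral => //.
  apply/measurable_EFinP/measurable_funTS; exact: measurableT_comp.
apply: integrable_fin_num => //.
exact: (eq_integrable mi _ _ _ (integrable_abse iuv)).
Qed.

End Averages.

(** * The hull of the averages is spanned by their 0/1 vectors *)

Unset Implicit Arguments.
Set Strict Implicit.

Theorem theorem4p1 (R : realType) (T sigma p : R)
    (hT : 0 < T) (hsigma : 0 < sigma) (hp : 1 <= p)
    (N : nat) (tau : 'I_N -> R) (c : 'I_N -> bool)
    (htau : forall j, 0 <= tau j < T)
    (tau_incr : forall j k : 'I_N, (j < k)%N -> tau j < tau k)
    (M : nat) (a b : 'I_M -> R)
    (hab : forall i, [/\ 0 <= a i, a i < b i & b i <= T])
    (Idisj : forall i k : 'I_M, i != k ->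
      `]a i, b i[ `&` `]a k, b k[ = set0)
    (tauI : forall (i : 'I_M) (j : 'I_N), tau j \notin `]a i, b i[) :
  zero_one_polytope
    (convex_hull (local_average a b @` Lp_closure T p (D_SP T sigma tau c))).
Proof.
set PC := local_average a b @` _.
pose V : set 'rV[R]_M :=
  [set v | PC v /\ forall i, v ord0 i = 0 \/ v ord0 i = 1].
exists V => [v [_ v01] i|]; first exact: v01.
(* A hull is the least convex superset, so it suffices that every convex set containing one
   generating set contains the other. Since [V] lies in [PC], only one direction needs work. *)
apply/seteqP; split => y yC C [Cconv CV]; apply: yC; split => //; last first.
  by move=> v [v1 _]; exact: CV.
move=> _ [u [uL ucl] <-].
have u1 := Lfun_Lfun1 hp uL.
have approx e : 0 < e -> exists2 v, D_SP T sigma tau c v & forall i,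
    `|local_average a b u ord0 i - local_average a b v ord0 i| <= e.
  move=> e0.
  have [eta [eta0 etae]] : exists eta : R, 0 < eta /\
      forall i, eta * (T + 1) / (b i - a i) <= e.
    have H : \forall eta \near (0 : R)^'+, forall i, eta * (T + 1) / (b i - a i) <= e.
      apply: filter_forall => i; have [_ ab _] := hab i.
      have ba : 0 < b i - a i by rewrite subr_gt0.
      have T1 : 0 < T + 1 by rewrite addr_gt0.
      near=> eta; rewrite ler_pdivrMr// -ler_pdivlMr//.
      by near: eta; apply: nbhs_right_le; rewrite divr_gt0// mulr_gt0.
    by have [eta [eta0 h]] := filter_ex (filterI (nbhs_right_gt 0) H); exists eta.
  have [v vD uv] := ucl eta eta0; exists v => // i; apply: le_trans (etae i).
  have [a0 ab bT] := hab i; have [[[v1 _] _ _] _] := vD.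
  exact: (average_Lnorm hT hp eta0 a0 ab bT u1 v1 uv).
have step v : D_SP T sigma tau c v -> exists g, [/\ rc_step T sigma g,
    {ae @lebesgue_measure R, forall x, x \in `]0, T[ -> g x = v x}
    & local_average a b v = local_average a b g].
  move=> [vD _]; have [g gs gv] := rc_version_exists hT vD; exists g; split=> //.
  by apply: (average_ae_eq hT hab gs) => //; have [[/Lfun1_itv[]]] := vD.
(* It remains to see that the average of [u] lies in the unit cube, as a limit of averages of steps,
   and that every vertex [w] of its smallest face is in [C]. *)
apply: (convex_set_cube Cconv) => [i|w wy].
  have bnd e : 0 < e -> - e <= local_average a b u ord0 i <= 1 + e.
    move=> /approx[v /step[g [gs _ ->]] /(_ i)]; rewrite ler_norml.
    by have /andP[] := average_itv hT hab gs i; lra.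
  apply/andP; split; apply/ler_addgt0Pl => e /bnd; lra.
(* With this [e], a function whose averages are within [e] of those of [u] has a positive average
   wherever [u] has one, and an average below 1 wherever [u] has one. *)
have [e e0 he] : exists2 e, 0 < e & forall i,
    (0 < local_average a b u ord0 i -> e < local_average a b u ord0 i) /\
    (local_average a b u ord0 i < 1 -> e < 1 - local_average a b u ord0 i).
  have H : \forall e \near (0 : R)^'+, forall i,
    (0 < local_average a b u ord0 i -> e < local_average a b u ord0 i) /\
    (local_average a b u ord0 i < 1 -> e < 1 - local_average a b u ord0 i).
    have pos (x : R) : \forall e \near (0 : R)^'+, 0 < x -> e < x.
      have [x0|x0] := ltP 0 x; last exact: nearW.
      by near=> e => _; near: e; exact: nbhs_right_lt.
    apply: filter_forall => i.
    near=> e; split; first by near: e; exact: pos.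
    by rewrite -subr_gt0; near: e; exact: pos.
  by have [e [e0 h]] := filter_ex (filterI (nbhs_right_gt 0) H); exists e.
have [v vD uv] := approx e e0; have [g [gs gv vg]] := step v vD.
(* Hence the step [g] takes the value [w ord0 i] somewhere in each interval, even if it is far from
   being constant there. *)
have att i : exists x, a i < x < b i /\ g x = w ord0 i.
  apply: (average_attains hab gs); rewrite -vg.
  have := uv i; rewrite ler_norml => /andP[? ?]; have [h1 h2] := he i.
  by case: (wy i) => -[-> h]; [left|right]; split=> //;
    [have := h2 h | have := h1 h]; lra.
have /fin_all_exists[s sP] := att.
have hs i : a i < s i < b i by have [] := sP i.
(* Splicing [g] at the points [s i] gives an element of the closure whose vector of averages is
   exactly [w]. *)
apply: CV; split.
  exists (splice T a b s 0 g);
    first exact: (splice_Lp_closure hT hp htau hab Idisj tauI vD gs gv hs).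
  rewrite (local_average_splice hab Idisj)//.
  by apply/rowP => i; rewrite mxE; have [_ ->] := sP i.
by move=> i; case: (wy i) => -[-> _]; [left|right].
Unshelve. all: by end_near. Qed.
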